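(* Let $\lambda/\mu$ be a skew shape (partitions $\mu\subseteq\lambda$). Then $$\sum_{\pi\in \mathrm{SSYT}(\lambda/\mu)} q^{|\pi|}\,t^{\mathrm{tr}(\pi)}\;=\;\sum_{S\in\mathcal{E}(\lambda/\mu)} q^{a(S)}\,t^{c(S)}\ \prod_{u\in\overline{S}\cap\square^\lambda}\frac{1}{1-t\,q^{h(u)}}\ \prod_{u\in\overline{S}\setminus\square^\lambda}\frac{1}{1-q^{h(u)}},$$ where $\overline{S}=[\lambda]\setminus S$, $a(S)=\sum_{(i,j)\in[\lambda]\setminus S}(\lambda'_j-i)$, and $c(S)=|\mathrm{supp}(A_S)\cap\square^\lambda|$ is the number of cells of the support of the excited array $A_S$ inside the Durfee square $\square^\lambda$ of $\lambda$.
   Context: $[\lambda]=\{(i,j):1\le i\le \ell(\lambda),\,1\le j\le\lambda_i\}$ is the Young diagram (rows numbered from the top, columns from the left), $\lambda'$ is the conjugate partition, and $h(i,j)=\lambda_i-i+\lambda'_j-j+1$ is the hook-length in $\lambda$. The Durfee square $\square^\lambda$ is the largest square $\{(i,j):1\le i,j\le k\}$ contained in $[\lambda]$. $\mathrm{SSYT}(\lambda/\mu)$ is the set of fillings $\pi$ of $[\lambda]\setminus[\mu]$ with nonnegative integers, weakly increasing along rows and strictly increasing down columns; $|\pi|$ is the sum of the entries and $\mathrm{tr}(\pi)=\sum_i\pi_{i,i}$ (sum over diagonal cells of $[\lambda]\setminus[\mu]$). Excited diagrams: for $D\subseteq[\lambda]$, a cell $u=(i,j)\in D$ is active if $(i+1,j)$,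 $(i,j+1)$, $(i+1,j+1)$ all lie in $[\lambda]\setminus D$; the excited move $\alpha_u$ at an active cell $u=(i,j)$ replaces $(i,j)$ in $D$ by $(i+1,j+1)$. $\mathcal{E}(\lambda/\mu)$ is the set of all subsets of $[\lambda]$ obtained from $[\mu]$ by a (possibly empty) sequence of excited moves. Excited arrays: for $1\le t\le\ell(\lambda)-1$ let $\mathsf{d}_t(\mu)=\{(i,j)\in[\lambda]\setminus[\mu]: j-i=\mu_t-t\}$ (with $\mu_t=0$ for $t>\ell(\mu)$). Let $A_\mu$ be the $0$-$1$ array of shape $\lambda$ with ones exactly on the cells of $\mathsf{d}_1(\mu)\cup\cdots\cup\mathsf{d}_{\ell(\lambda)-1}(\mu)$. For a $0$-$1$ array $A$ of shape $\lambda$ and $u=(i,j)$ with $A_{i+1,j}=0$ and $A_{i+1,j+1}=1$, let $\beta_u(A)$ be the array obtained from $A$ by setting the entry at $(i+1,j+1)$ to $0$ and the entry at $(i+1,j)$ to $1$. If $D=\alpha_{u_k}\circ\cdots\circ\alpha_{u_1}([\mu])$ is obtained by a sequence of excited moves, then $A_D=\beta_{u_k}\circ\cdots\circ\beta_{u_1}(A_\mu)$; this is well defined and independent of the chosen sequence. $\mathrm{supp}(A)$ is the set of cells where $A$ is nonzero. *)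

(* Defs.v *)
From HB Require Import structures.
From mathcomp Require Import all_boot all_order all_algebra finmap.
From mathcomp Require Import boolp classical_sets functions cardinality fsbigop.
Set Implicit Arguments.
Unset Strict Implicit.
Unset Printing Implicit Defensive.
Import Order.TTheory GRing.Theory Num.Theory.
Local Open Scope ring_scope.

(******************************************************************************)
(* Formal power series R[[X]] over a commutative ring R                       *)
(******************************************************************************)

Record fps (R : Type) := Fps { fcoef : nat -> R }.

HB.instance Definition _ (R : Type) := gen_eqMixin (fps R).
HB.instance Definition _ (R : Type) := gen_choiceMixin (fps R).

Lemma fpsP (R : Type) (f g : fps R) :
  (forall n, fcoef f n = fcoef g n) -> f = g.
Proof. by case: f g => f [g] /= fg; congr Fps; apply/funext. Qed.

Section FpsZmodule.
Variable R : zmodType.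
Implicit Types f g h : fps R.

Definition fps_zero : fps R := Fps (fun=> 0).
Definition fps_opp f : fps R := Fps (fun n => - fcoef f n).
Definition fps_add f g : fps R := Fps (fun n => fcoef f n + fcoef g n).

Lemma fps_addA : associative fps_add.
Proof. by move=> f g h; apply: fpsP => n /=; rewrite addrA. Qed.
Lemma fps_addC : commutative fps_add.
Proof. by move=> f g; apply: fpsP => n /=; rewrite addrC. Qed.
Lemma fps_add0 : left_id fps_zero fps_add.
Proof. by move=> f; apply: fpsP => n /=; rewrite add0r. Qed.
Lemma fps_addN : left_inverse fps_zero fps_opp fps_add.
Proof. by move=> f; apply: fpsP => n /=; rewrite addNr. Qed.

HB.instance Definition _ :=
  GRing.isZmodule.Build (fps R) fps_addA fps_addC fps_add0 fps_addN.
End FpsZmodule.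

Section FpsRing.
Variable R : comNzRingType.
Implicit Types f g h : fps R.

Definition fpsC (c : R) : fps R := Fps (fun n => if n is 0 then c else 0).
Definition fpsX : fps R := Fps (fun n => (n == 1%N)%:R).

Definition fps_one : fps R := fpsC 1.
Definition fps_mul f g : fps R :=
  Fps (fun n => \sum_(i < n.+1) fcoef f i * fcoef g (n - i)).

Definition fps_trunc n f : {poly R} := \poly_(i < n.+1) fcoef f i.

Lemma fps_mul_trunc f g n m : (n <= m)%N ->
  fcoef (fps_mul f g) n = (fps_trunc m f * fps_trunc m g)`_n.
Proof.
move=> nm; rewrite coefM /=; apply: eq_bigr => i _; rewrite !coef_poly !ltnS.
by rewrite (leq_trans (leq_subr i n) nm) (leq_trans (leq_ord i) nm).
Qed.

Lemma fps_mulC : commutative fps_mul.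
Proof.
by move=> f g; apply: fpsP => n; rewrite !(fps_mul_trunc _ _ (leqnn n)) mulrC.
Qed.

Lemma fps_mulA : associative fps_mul.
Proof.
move=> f g h; apply: fpsP => n.
transitivity ((fps_trunc n f * (fps_trunc n g * fps_trunc n h))`_n).
  rewrite coefM /=; apply: eq_bigr => i _.
  rewrite -[\sum_(_ < _) _]/(fcoef (fps_mul g h) (n - i)).
  by rewrite (fps_mul_trunc _ _ (leq_subr i n)) coef_poly ltn_ord.
rewrite mulrA coefM; apply: eq_bigr => i _.
by rewrite -(fps_mul_trunc _ _ (leq_ord i)) coef_poly ltnS leq_subr.
Qed.

Lemma fps_mul1 : left_id fps_one fps_mul.
Proof.
move=> f; apply: fpsP => n /=; rewrite big_ord_recl /= mul1r subn0.
by rewrite big1 ?addr0 // => i _; rewrite mul0r.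
Qed.

Lemma fps_mulDl : left_distributive fps_mul +%R.
Proof.
move=> f g h; apply: fpsP => n /=; rewrite -big_split /=.
by apply: eq_bigr => i _; rewrite mulrDl.
Qed.

Lemma fps_one_neq0 : fps_one != 0.
Proof. by apply/eqP => /(congr1 (fun f => fcoef f 0)) /eqP /=; rewrite oner_eq0. Qed.

HB.instance Definition _ := GRing.Zmodule_isComNzRing.Build (fps R)
  fps_mulA fps_mulC fps_mul1 fps_mulDl fps_one_neq0.

Definition fps_unit : pred (fps R) := fun f => `[< exists g, g * f = 1 >].
Definition fps_inv (f : fps R) : fps R := xget f [set g | g * f = 1]%classic.

Lemma fps_mulVr : {in fps_unit, left_inverse 1 fps_inv *%R}.
Proof. by move=> f /asboolP; apply: xgetPex. Qed.

Lemma fps_unitP f g : g * f = 1 -> fps_unit f.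
Proof. by move=> gf1; apply/asboolP; exists g. Qed.

Lemma fps_inv_out : {in [predC fps_unit], fps_inv =1 id}.
Proof.
by move=> f /asboolPn nf; apply: xgetPN => g gf1; apply: nf; exists g.
Qed.

HB.instance Definition _ := GRing.ComNzRing_hasMulInverse.Build (fps R)
  fps_mulVr fps_unitP fps_inv_out.

Lemma fcoef_mul f g n :
  fcoef (f * g) n = \sum_(i < n.+1) fcoef f i * fcoef g (n - i).
Proof. by []. Qed.

Lemma fcoef_sum (I : Type) (r : seq I) (P : pred I) (F : I -> fps R) n :
  fcoef (\sum_(i <- r | P i) F i) n = \sum_(i <- r | P i) fcoef (F i) n.
Proof. exact: (big_morph (fun f => fcoef f n)). Qed.

Lemma fcoef_exp_small g k n :
  fcoef g 0 = 0 -> (n < k)%N -> fcoef (g ^+ k) n = 0.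
Proof.
move=> g0; elim: k n => [//|k IHk] n nk; rewrite exprS fcoef_mul.
apply: big1 => -[[|i] /= lt_in] _; first by rewrite g0 mul0r.
have in_k : (n - i.+1 < k)%N.
  by rewrite ltn_subLR // (leq_trans nk) // ltnS leq_addl.
by rewrite (IHk _ in_k) mulr0.
Qed.

Lemma fps_unit_coef0 f : fcoef f 0 = 1 -> f \is a GRing.unit.
Proof.
move=> f0; set g := 1 - f; have g0 : fcoef g 0 = 0 by rewrite /= f0 subrr.
have geomE n m : (m <= n)%N -> fcoef (\sum_(k < n.+1) g ^+ k) m
    = fcoef (\sum_(k < m.+1) g ^+ k) m.
  move=> mn; rewrite !fcoef_sum.
  rewrite [RHS](big_ord_widen n.+1 (fun k => fcoef (g ^+ k) m)) // [RHS]big_mkcond.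
  apply: eq_bigr => k _; case: ifPn => //; rewrite -leqNgt.
  exact: fcoef_exp_small.
apply/asboolP; exists (Fps (fun n => fcoef (\sum_(k < n.+1) g ^+ k) n)).
apply: fpsP => n; rewrite mulrC.
transitivity (fcoef (f * \sum_(k < n.+1) g ^+ k) n).
  by rewrite !fcoef_mul; apply: eq_bigr => i _; rewrite geomE ?leq_subr.
rewrite -[f in f * _](subKr 1) -/g -opprB mulNr -subrX1 opprB.
have -> : fcoef (1 - g ^+ n.+1) n = fcoef (1 : fps R) n - fcoef (g ^+ n.+1) n.
  by [].
by rewrite (fcoef_exp_small g0 (ltnSn n)) subr0.
Qed.
End FpsRing.

(* Z[[q, t]] is realised as (Z[[t]])[[q]]: the coefficient of q ^ n t ^ m in  *)
(* f is fcoef (fcoef f n) m.                                                  *)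
Notation qtseries := (fps (fps int)).
Definition q : qtseries := fpsX (fps int).
Definition t : qtseries := fpsC (fpsX int).

(* The formal sum of a family of series, taken coefficientwise. It is meant   *)
(* for families in which every monomial occurs in finitely many members; the  *)
(* library sum over \in would return 0 for a monomial occurring infinitely    *)
(* often.                                                                     *)
Definition qtsum (I : choiceType) (A : set I) (F : I -> qtseries) : qtseries :=
  Fps (fun n => Fps (fun m => \sum_(i \in A) fcoef (fcoef (F i) n) m)).

(******************************************************************************)
(* Partitions and Young diagrams                                              *)
(******************************************************************************)

Local Open Scope nat_scope.

Definition is_partition (la : seq nat) : bool := sorted geq la && (0 \notin la).

(* Cells are pairs (row, column), both numbered from 1. *)
Definition cell : Type := (nat * nat)%type.

(* la_i, for i >= 1, with la_i = 0 past the length of la. *)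
Definition part (la : seq nat) (i : nat) : nat := nth 0 la i.-1.

Definition conj_part (la : seq nat) (j : nat) : nat :=
  count (fun x => j <= x) la.

Definition diagram (la : seq nat) : {fset nat * nat} :=
  [fset u in [seq (i, j) | i <- iota 1 (size la), j <- iota 1 (part la i)]]%fset.

Definition skew_diagram (la mu : seq nat) : {fset nat * nat} :=
  (diagram la `\` diagram mu)%fset.

(* The subtraction is performed last, so that it does not truncate when u is  *)
(* a cell of la.                                                              *)
Definition hook (la : seq nat) (u : cell) : nat :=
  (part la u.1 + conj_part la u.2).+1 - (u.1 + u.2).

Definition square (k : nat) : {fset nat * nat} :=
  [fset u in [seq (i, j) | i <- iota 1 k, j <- iota 1 k]]%fset.

Definition durfee_size (la : seq nat) : nat :=
  \max_(k < (size la).+1 | (square k `<=` diagram la)%fset) k.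

Definition durfee (la : seq nat) : {fset nat * nat} := square (durfee_size la).

(******************************************************************************)
(* Semistandard Young tableaux of skew shape, with entries in nat             *)
(******************************************************************************)

Definition filling (la mu : seq nat) : Type :=
  {ffun skew_diagram la mu -> nat}.
HB.instance Definition _ (la mu : seq nat) := Choice.on (filling la mu).

Definition SSYT (la mu : seq nat) : set (filling la mu) :=
  [set pi : filling la mu |
    (forall u v : skew_diagram la mu,
       (val u).1 = (val v).1 -> (val u).2 <= (val v).2 -> pi u <= pi v) /\
    (forall u v : skew_diagram la mu,
       (val u).2 = (val v).2 -> (val u).1 < (val v).1 -> pi u < pi v)]%classic.

Arguments SSYT la mu : clear implicits.

Definition weight (la mu : seq nat) (pi : filling la mu) : nat :=
  \sum_(u : skew_diagram la mu) pi u.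

Definition trace (la mu : seq nat) (pi : filling la mu) : nat :=
  \sum_(u : skew_diagram la mu | (val u).1 == (val u).2) pi u.

(******************************************************************************)
(* Excited diagrams                                                           *)
(******************************************************************************)

Definition active (la : seq nat) (D : {fset nat * nat}) (u : cell) : bool :=
  let: (i, j) := u in
  [&& (i, j) \in D, (i.+1, j) \in (diagram la `\` D)%fset,
      (i, j.+1) \in (diagram la `\` D)%fset
    & (i.+1, j.+1) \in (diagram la `\` D)%fset].

Definition alpha (u : cell) (D : {fset nat * nat}) : {fset nat * nat} :=
  ((u.1.+1, u.2.+1) |` (D `\ u))%fset.

Inductive excited (la mu : seq nat) : {fset nat * nat} -> Prop :=
| excited_init : excited la mu (diagram mu)
| excited_move D u :
    excited la mu D -> active la D u -> excited la mu (alpha u D).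

Definition excited_diagrams (la mu : seq nat) : {fset {fset nat * nat}} :=
  [fset D in fpowerset (diagram la) | `[< excited la mu D >]]%fset.

(******************************************************************************)
(* Excited arrays                                                             *)
(******************************************************************************)

(* A 0-1 array of shape la, extended by 0 (false) outside of la. *)
Definition array : Type := nat * nat -> bool.

(* The equation j - i = mu_r - r is written without subtraction. *)
Definition diag_cells (la mu : seq nat) (r : nat) : {fset nat * nat} :=
  [fset u in skew_diagram la mu | (u.2 + r == part mu r + u.1)%N]%fset.

(* Here r ranges over 1 <= r <= size la - 1. *)
Definition init_array (la mu : seq nat) : array :=
  fun u => has (fun r => u \in diag_cells la mu r) (iota 1 (size la).-1).

Definition beta_defined (A : array) (u : cell) : bool :=
  ~~ A (u.1.+1, u.2) && A (u.1.+1, u.2.+1).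

Definition beta (u : cell) (A : array) : array :=
  fun v => if v == (u.1.+1, u.2.+1) then false
           else if v == (u.1.+1, u.2) then true
           else A v.

(* excited_pair la mu D A: some sequence of excited moves u_1, ..., u_k leads *)
(* from mu to D, and the corresponding beta moves, each of them being         *)
(* defined, lead from A_mu to A.                                              *)
Inductive excited_pair (la mu : seq nat) : {fset nat * nat} -> array -> Prop :=
| excited_pair_init : excited_pair la mu (diagram mu) (init_array la mu)
| excited_pair_move D A u :
    excited_pair la mu D A -> active la D u -> beta_defined A u ->
    excited_pair la mu (alpha u D) (beta u A).

(* The array A_D. For an excited diagram D there is exactly one A such that   *)
(* excited_pair la mu D A; the default value is used only for other D.        *)
Definition excited_array (la mu : seq nat) (D : {fset nat * nat}) : array :=
  xget (fun=> false) [set A : array | excited_pair la mu D A]%classic.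

Definition support (la : seq nat) (A : array) : {fset nat * nat} :=
  [fset u in diagram la | A u]%fset.

Definition aexp (la : seq nat) (S : {fset nat * nat}) : nat :=
  \sum_(u <- (diagram la `\` S)%fset) (conj_part la u.2 - u.1).

Definition cexp (la mu : seq nat) (S : {fset nat * nat}) : nat :=
  #|` (support la (excited_array la mu S) `&` durfee la)%fset |.

(* Main.v *)
(* A partition with at most n parts is encoded by a set of n beads (the       *)
(* vertical steps of its boundary); the number ht A p of beads from p on is   *)
(* the row in which the boundary meets a diagonal. Let G(la/mu) be the sum    *)
(* over excited diagrams, for weights w attached to the cells of la with      *)
(* compatible weights x of the diagonals. Removing a corner c of la splits    *)
(* the excited diagrams S: those avoiding c are excited diagrams of           *)
(* (la - c)/mu, and those containing c, with c removed, are the excited       *)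
(* diagrams of (la - c)/mu^-, where mu^- is mu with its corner on the         *)
(* diagonal of c removed. The resulting two-term recursion yields, by         *)
(* induction on la, the Pieri rule                                            *)
(*     G(la/mu) = \sum_(nu/mu horizontal strip) x^(la/nu) G(la/nu),           *)
(* whose induction step reduces to an identity for each nu separately.        *)
(* The generating function of semistandard tableaux satisfies the same rule:  *)
(* the zero entries of a tableau form a horizontal strip nu/mu, and the other *)
(* entries can be lowered by 1. As x^(la/nu) is divisible by q when           *)
(* nu <> la, the rule determines all coefficients by induction on the degree. *)
(* The support of the excited array of S is recovered from the numbers of     *)
(* cells of S on adjacent diagonals (arr S below), and its hook lengths sum   *)
(* to a(S) by double counting.                                                *)

Require Import Defs.
From mathcomp Require Import all_boot all_order all_algebra finmap.
From mathcomp Require Import boolp classical_sets functions cardinality fsbigop.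
From mathcomp Require Import perm zify ring.
Set Implicit Arguments.
Unset Strict Implicit.
Unset Printing Implicit Defensive.
Import Order.TTheory GRing.Theory Num.Theory.
Local Open Scope nat_scope.

(** * Heights of bead configurations *)

(** A bead set [A] of size [n] stands for the shape [dg n A], and [Gsum] is a weighted sum over
    excited diagrams in which each cell [v] with [arr S v] contributes [w v] and each cell outside
    [S] contributes [(1 - w v)^-1]. Both sides of the theorem satisfy one recursion over horizontal
    strips, and this recursion has a unique solution.

    On the excited side, [Gsum_corner] is the two-term recursion for a corner of the outer shape,
    and [pieri_step] turns it into the induction step of [pieri]. The Pieri rule needs the weight of
    each cell to be a ratio [Z p' / Z p], where [p] is the bead of its row and [p'] the hole of its
    column. Hook lengths and the Durfee square enter here: by [wt_pos_hook] the weights q^h(u), with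
    a factor t inside the Durfee square, are such ratios. [monom_dg] rewrites the resulting
    monomials as products of q over the cells removed, with a t for each diagonal cell, which gives
    [Gsum_rec].

    On the tableau side, [ssyt_sum_rec] splits off the zero entries and lowers the others by one.
    [fcoef_ssyt_sum] compares the two recursions degree by degree in q.

    It remains to translate back. [fcoef_SSYT] reduces each coefficient of the formal sum to bounded
    fillings. [excited_pairE] identifies the excited array with [arr], and [sum_hook_arr] shows that
    its hook lengths add up to a(S). *)

Section Heights.
Variable N : nat.
Implicit Types A B : {set 'I_N}.

Definition ht A (p : nat) : nat := #|[set x in A | p <= x]|.

Lemma ht0 A : ht A 0 = #|A|.
Proof. by apply: eq_card => x; rewrite !inE andbT. Qed.

Lemma htS A (x : 'I_N) : ht A x = (x \in A) + ht A x.+1.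
Proof.
rewrite /ht (cardsD1 x) !inE leqnn andbT; congr (_ + _).
apply: eq_card => y; rewrite !inE; case: (y \in A); rewrite ?andbF //=.
by rewrite [RHS]ltn_neqAle eq_sym.
Qed.

Lemma ht_out A p : N <= p -> ht A p = 0.
Proof.
move=> Np; apply: eq_card0 => x; rewrite !inE.
by apply/negP => /andP[_]; rewrite leqNgt (leq_trans (ltn_ord x)).
Qed.

Lemma ht_step A p : ht A p.+1 <= ht A p <= (ht A p.+1).+1.
Proof.
have [pN|Np] := ltnP p N; last by rewrite !ht_out // ltnW.
by have /= -> := htS A (Ordinal pN); case: (_ \in _);
  rewrite ?add0n ?add1n ?leqnn ?leqnSn.
Qed.

Lemma ht_subn A p r : ht A (p + r) <= ht A p <= ht A (p + r) + r.
Proof.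
elim: r => [|r /andP[IH1 IH2]]; first by rewrite !addn0 leqnn.
by have := ht_step A (p + r); rewrite addnS; lia.
Qed.

Lemma ht_leq A p : ht A p <= N - p.
Proof.
have [pN|Np] := leqP p N; last by rewrite ht_out // ltnW.
by have := ht_subn A p (N - p); rewrite ht_out; lia.
Qed.

Lemma ht_card A p : ht A p <= #|A|.
Proof. by have := ht_subn A 0 p; rewrite ht0 => /andP[]. Qed.

Lemma ht_geq A p : #|A| - p <= ht A p.
Proof. by have := ht_subn A 0 p; rewrite ht0 add0n; lia. Qed.

Lemma ht_inj A B : ht A =1 ht B -> A = B.
Proof.
move=> hAB; apply/setP => x; have := htS A x.
by rewrite !hAB htS => /addIn; do 2!case: (x \in _).
Qed.

(* The shape of B is obtained from that of A by adding a horizontal strip. *)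
Definition hstrip A B : bool :=
  [forall x : 'I_N, ht A x <= ht B x <= (ht A x.+1).+1].

Lemma hstripP A B :
  reflect (forall p, ht A p <= ht B p <= (ht A p.+1).+1) (hstrip A B).
Proof.
apply: (iffP forallP) => [hAB p|//].
by have [pN|Np] := ltnP p N; [apply: (hAB (Ordinal pN)) | rewrite !ht_out // ltnW].
Qed.

Section Swap.
Variables a b : 'I_N.
Hypothesis ab : b.+1 = a :> nat.

(** When [a] is occupied and [b] is not, this pushes a bead one position down, which removes a
    corner of the shape ([dg_sw]). *)
Definition sw A := [set x | tperm a b x \in A].

Lemma swK : involutive sw.
Proof. by move=> A; apply/setP => x; rewrite !inE tpermK. Qed.

Lemma sw_a A : (a \in sw A) = (b \in A). Proof. by rewrite inE tpermL. Qed.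
Lemma sw_b A : (b \in sw A) = (a \in A). Proof. by rewrite inE tpermR. Qed.

Lemma sw_preim A : sw A = tperm a b @: A.
Proof.
apply/setP => x; rewrite inE; apply/idP/imsetP => [xA|[y yA ->]].
  by exists (tperm a b x); rewrite ?tpermK.
by rewrite tpermK.
Qed.

Lemma card_sw A : #|sw A| = #|A|.
Proof. by rewrite sw_preim card_imset //; apply: perm_inj. Qed.

Lemma ht_sw A (p : nat) : p != a -> ht (sw A) p = ht A p.
Proof.
move=> pa; rewrite /ht sw_preim.
rewrite -(card_imset [set x in A | p <= x] (@perm_inj _ (tperm a b))).
apply: eq_card => x; rewrite !inE.
have pE : (p <= tperm a b x) = (p <= x).
  case: tpermP => [->|->|//]; lia.
apply/idP/imsetP => [/andP[/imsetP[y yA xy] px]|[y]].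
  by exists y => //; rewrite inE yA -pE xy tpermK in px *.
rewrite inE => /andP[yA py] xE; move: pE; rewrite xE tpermK py => <-.
by rewrite andbT; apply/imsetP; exists y.
Qed.

Lemma ht_a A : ht A a = (a \in A) + ht A a.+1. Proof. exact: htS. Qed.

Lemma ht_b A : ht A b = (b \in A) + (a \in A) + ht A a.+1.
Proof. by rewrite htS ab ht_a addnA. Qed.

Lemma ht_swa A : ht (sw A) a = (b \in A) + ht A a.+1.
Proof. by rewrite ht_a sw_a ht_sw // gtn_eqF. Qed.

Lemma sw_id A : (a \in A) = (b \in A) -> sw A = A.
Proof.
move=> abA; apply/setP => x; rewrite inE.
by have [->|->|//] := tpermP a b x; rewrite abA.
Qed.

(** A swap changes [ht] only at [a], and the condition at [b] reads [ht A a]; so the conditions kept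
    here are those that no swap affects. *)
Definition hstrip_away A B : bool :=
  [forall x : 'I_N, (x != a) ==> (x != b) ==> (ht A x <= ht B x <= (ht A x.+1).+1)].

Lemma hstrip_awayl A B : hstrip_away (sw A) B = hstrip_away A B.
Proof.
apply: eq_forallb => x; have [//|xa] := eqVneq x a.
have [//|xb] := eqVneq x b; rewrite !ht_sw //.
by apply: contraNneq xb => xa'; apply/eqP/val_inj/eqP; rewrite /= -eqSS ab xa'.
Qed.

Lemma hstrip_awayr A B : hstrip_away A (sw B) = hstrip_away A B.
Proof. by apply: eq_forallb => x; have [//|xa] := eqVneq x a; rewrite ht_sw. Qed.

Lemma hstrip_awayP A B : hstrip_away A B -> ht A a.+1 <= ht B a.+1.
Proof.
move=> hAB; have [aN|Na] := ltnP a.+1 N; last by rewrite ht_out.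
have := forallP hAB (Ordinal aN); rewrite -!(inj_eq val_inj) /=.
by rewrite -ab !gtn_eqF //= => /andP[].
Qed.

Lemma hstrip_local A B : hstrip A B =
  hstrip_away A B &&
  [&& (a \in A) + ht A a.+1 <= (a \in B) + ht B a.+1,
      (a \in B) + ht B a.+1 <= (ht A a.+1).+1,
      (b \in A) + (a \in A) + ht A a.+1 <= (b \in B) + (a \in B) + ht B a.+1
    & (b \in B) + (a \in B) + ht B a.+1 <= ((a \in A) + ht A a.+1).+1].
Proof.
apply/idP/idP => [hAB|/andP[hAB loc]].
  apply/andP; split.
    by apply/forallP => x; apply/implyP => _; apply/implyP => _; apply: (forallP hAB).
  have := forallP hAB a; have := forallP hAB b.
  by rewrite !ht_b ab !ht_a => /andP[-> ->] /andP[-> ->].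
apply/forallP => x; have [->|xa] := eqVneq x a.
  by rewrite !ht_a; case/and4P: loc => -> ->.
have [->|xb] := eqVneq x b.
  by rewrite !ht_b ab ht_a; case/and4P: loc => _ _ -> ->.
by have := forallP hAB x; rewrite xa xb.
Qed.
End Swap.
End Heights.

(** * The induction step of the Pieri rule *)

Ltac decide_leq :=
  repeat match goal with |- context [leq ?u ?v] =>
    first [have -> : leq u v = true by lia | have -> : leq u v = false by lia]
  end.

Section PieriStep.
Local Open Scope ring_scope.
Variables (R : comNzRingType) (N : nat) (a b : 'I_N) (y : R) (Z : 'I_N -> R).
Hypotheses (ab : b.+1 = a :> nat) (Zab : Z b = y * Z a).
Implicit Types A B : {set 'I_N}.

Definition monom (f : 'I_N -> R) A : R := \prod_(x in A) f x.

Lemma monom_sw A : monom (Z \o tperm a b) A = monom Z (sw a b A).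
Proof.
rewrite /monom (reindex_inj (@perm_inj _ (tperm a b))) /=.
by apply: eq_big => [x|x _]; rewrite ?inE ?tpermK.
Qed.

Lemma monom_sw_outer A :
  a \in A -> b \notin A -> monom Z (sw a b A) = y * monom Z A.
Proof.
move=> aA bA; have ba : b != a by apply: contraNneq bA => ->.
rewrite /monom (bigD1 b) ?(sw_b _ _) //= [in RHS](bigD1 a) //= Zab mulrA.
congr (_ * _); apply: eq_bigl => x; rewrite !inE.
have [->|->|xa xb] := tpermP a b x; first by rewrite (negPf bA) eqxx andbF.
  by rewrite (negPf bA) eqxx andbF.
by rewrite (introF eqP xa) (introF eqP xb).
Qed.

(* The coefficient of g B in pieri_step: it only involves the beads of A and B *)
(* at a and b, and ht A a.+1 and ht B a.+1.                                   *)
Lemma pieri_coef A B :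
  y ^+ (a \in A) * (hstrip A B)%:R * monom Z (sw a b B) +
  (1 - y) * ((a \in A) && (b \notin A))%:R * (hstrip (sw a b A) B)%:R
    * monom Z (sw a b B) =
  (hstrip A B)%:R * monom Z B * y ^+ (a \in B) +
  (1 - y) * ((a \notin B) && (b \in B))%:R * (hstrip A (sw a b B))%:R
    * monom Z (sw a b B).
Proof.
have WB : monom Z B = (if (a \notin B) && (b \in B) then y else 1) * monom Z (sw a b B)
   \/ (a \in B) && (b \notin B).
  case aB : (a \in B); case bB : (b \in B) => /=; try by right.
  - by left; rewrite mul1r sw_id ?aB ?bB.
  - left; rewrite -{1}(swK a b B) monom_sw_outer ?sw_a ?sw_b ?aB ?bB //.
  - by left; rewrite mul1r sw_id ?aB ?bB.
have WB' : (a \in B) && (b \notin B) -> monom Z (sw a b B) = y * monom Z B.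
  by case/andP; apply: monom_sw_outer.
rewrite !(hstrip_local ab) hstrip_awayl // hstrip_awayr // !sw_a !sw_b.
rewrite !(ht_sw ab) ?(gtn_eqF (ltnSn a)) //.
case away: (hstrip_away _ _ _ _); last by rewrite /= !(mulr0, mul0r) addr0.
have := hstrip_awayP ab away; move: (ht A a.+1) (ht B a.+1) => u v uv.
(* For [v >= u + 2] no strip condition can hold. In each range the bead memberships decide every
   inequality and leave a polynomial identity. *)
have cases : [|| v == u, v == u.+1 | (u.+2 <= v)%N] by lia.
move: WB WB'; case: (a \in A); case: (b \in A); case: (a \in B); case: (b \in B);
  move=> /= WB WB'; (case/or3P: cases => [/eqP v_u|/eqP v_u|v_u]);
  decide_leq; rewrite /= ?(mulr1n, mulr0n, expr0, expr1);
  try rewrite (WB' isT); try (case: WB => // ->); ring.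
Qed.

(** [G] belongs to a shape, [g] to the shape without a corner of weight [y]. The hypotheses are the
    corner recursion and the Pieri rule for [g] with two values of [Z] exchanged. Both sides are
    expanded in the [g B], after reindexing one sum by the swap, and compared through
    [pieri_coef]. *)
Lemma pieri_step (g G : {set 'I_N} -> R) (M0 : R) A :
    (forall B, (1 - y) * G B = y ^+ (a \in B) * g B +
       (1 - y) * ((a \in B) && (b \notin B))%:R * g (sw a b B)) ->
    (forall B, #|B| = #|A| ->
       M0 * g B = \sum_C (hstrip B C)%:R * monom Z (sw a b C) * g C) ->
  (1 - y) * (M0 * G A) = (1 - y) * \sum_B (hstrip A B)%:R * monom Z B * G B.
Proof.
move=> GE gE; rewrite mulrCA GE mulrDr mulrCA gE //.
rewrite [M0 * (_ * g (sw _ _ _))]mulrCA gE ?card_sw // !mulr_sumr -big_split /=.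
rewrite [RHS](eq_bigr (fun B => (hstrip A B)%:R * monom Z B * y ^+ (a \in B) * g B +
    (hstrip A B)%:R * monom Z B * (1 - y) * ((a \in B) && (b \notin B))%:R
      * g (sw a b B))); last by move=> B _; rewrite mulrCA GE; ring.
rewrite [RHS]big_split /= [X in _ = _ + X](reindex_inj (can_inj (@swK _ a b))) /=.
rewrite -big_split /=; apply: eq_bigr => B _; rewrite swK sw_a sw_b.
rewrite [(b \in B) && _]andbC; have /(congr1 ( *%R^~ (g B))) E := pieri_coef A B.
by etransitivity; [etransitivity; [|exact: E] |]; ring.
Qed.
End PieriStep.

(** * Excited diagrams and corners *)

Section GenericExcited.
Local Open Scope fset_scope.
Local Open Scope nat_scope.
Implicit Types (L M D : {fset nat * nat}) (u v c p : nat * nat).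

Definition is_young L : Prop :=
  (forall i j, (i, j) \in L -> 0 < i /\ 0 < j) /\
  (forall i j i' j', (i, j) \in L -> 0 < i' <= i -> 0 < j' <= j -> (i', j') \in L).

Definition corner L c : Prop :=
  [/\ c \in L, (c.1.+1, c.2) \notin L & (c.1, c.2.+1) \notin L].

Definition act L D u : bool :=
  [&& u \in D, (u.1.+1, u.2) \in L `\` D, (u.1, u.2.+1) \in L `\` D
    & (u.1.+1, u.2.+1) \in L `\` D].

Inductive exc L M : {fset nat * nat} -> Prop :=
| exc_init : exc L M M
| exc_move D u : exc L M D -> act L D u -> exc L M (alpha u D).

Lemma excitedE la mu D : excited la mu D <-> exc (diagram la) (diagram mu) D.
Proof.
split; elim=> [|{}D [i j] _ IH act_u]; by [constructor | constructor].
Qed.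

Lemma in_alpha D u v :
  (v \in alpha u D) = (v == (u.1.+1, u.2.+1)) || (v != u) && (v \in D).
Proof. by rewrite !inE. Qed.

Lemma exc_sub L M D : M `<=` L -> exc L M D -> D `<=` L.
Proof.
move=> ML; elim=> // {}D u _ DL /and4P[_ _ _]; rewrite inE => /andP[_ uL].
apply/fsubsetP => v; rewrite in_alpha => /orP[/eqP->//|/andP[_]].
exact/fsubsetP.
Qed.

Lemma corner_max L c i j : is_young L -> corner L c ->
  (i, j) \in L -> c.1 <= i -> c.2 <= j -> (i, j) = c.
Proof.
move=> Ly [rsL downL rightL] ijL; move: rsL downL rightL.
case: c => [r s] /= rsL downL rightL le_ri le_sj.
have [r0 s0] := Ly.1 _ _ rsL.
have ir : i <= r.
  rewrite leqNgt; apply/negP => lt_ri; case/negP: downL.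
  by apply: Ly.2 ijL _ _; lia.
have js : j <= s.
  rewrite leqNgt; apply/negP => lt_sj; case/negP: rightL.
  by apply: Ly.2 ijL _ _; lia.
by congr (_, _); lia.
Qed.

Lemma diag_eq u v c : u.2 + c.1 = c.2 + u.1 -> v.2 + c.1 = c.2 + v.1 ->
  u.1 = v.1 -> u = v.
Proof. by case: u v c => [i j] [i' j'] [r s] /= *; congr (_, _); lia. Qed.

Section Corner.
Variables (L : {fset nat * nat}) (c : nat * nat).
Hypotheses (Ly : is_young L) (cL : corner L c).

Lemma exc_corner M D : exc (L `\ c) M D -> exc L M D.
Proof.
elim=> [|{}D u _ IH /and4P[uD]]; first by constructor.
rewrite !inE => /andP[u1D /andP[_ u1L]] /andP[u2D /andP[_ u2L]].
move=> /andP[u3D /andP[_ u3L]]; apply: exc_move => //.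
by apply/and4P; split; rewrite // !inE ?u1D ?u2D ?u3D.
Qed.

(** Neither neighbour of [u] can be [c]: the target of the move, a cell of [L], would then lie
    directly right of or below the corner. *)
Lemma act_corner D D' u :
    (forall v, v != c -> v \notin D -> v \notin D') ->
    u \in D' -> (u.1.+1, u.2.+1) != c ->
  act L D u -> act (L `\ c) D' u.
Proof.
case: cL => _ downL rightL DD' uD' u3c /and4P[uD]; rewrite !inE.
move=> /andP[u1D u1L] /andP[u2D u2L] /andP[u3D u3L].
have u1c : (u.1.+1, u.2) != c.
  by apply: contraNneq rightL => <-.
have u2c : (u.1, u.2.+1) != c.
  by apply: contraNneq downL => <-.
by apply/and4P; split; rewrite // !inE !DD' ?u1c ?u2c ?u3c.
Qed.

(** A cell that has reached the corner can never leave it, so moves ending without [c] avoid [c]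
    throughout. *)
Lemma exc_notin_corner M D : exc L M D -> c \notin D -> exc (L `\ c) M D.
Proof.
elim=> [|{}D u _ IH act_u]; first by constructor.
rewrite in_alpha negb_or negb_and negbK => /andP[u3c].
have [uc _|cu /= cD] := eqVneq c u.
  case: cL => _ downL _; case/and4P: act_u => _; rewrite -uc inE => /andP[_].
  by rewrite (negPf downL).
apply: exc_move; first exact: IH.
have uD : u \in D by case/and4P: act_u.
by apply: act_corner act_u; rewrite // eq_sym.
Qed.

Lemma exc_mem_corner M D : c \in M -> exc L M D -> c \in D.
Proof.
move=> cM; elim=> // {}D u _ cD /and4P[_];
  rewrite in_alpha cD andbT inE => /andP[_ uL] _ _.
by apply/orP; right; apply: contraTneq uL => <-; case: cL.
Qed.

(* When the last cell p of D on the diagonal of c is removed, its own moves    *)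
(* become invisible and all the other moves remain possible.                  *)
Lemma exc_last M D p0 : M `<=` L ->
    p0 \in M -> p0.2 + c.1 = c.2 + p0.1 ->
    (forall x, x \in M -> x.2 + c.1 = c.2 + x.1 -> x.1 <= p0.1) ->
    exc L M D ->
  exists p, [/\ p \in D, p.2 + c.1 = c.2 + p.1,
    (forall x, x \in D -> x.2 + c.1 = c.2 + x.1 -> x.1 <= p.1)
    & exc (L `\ c) (M `\ p0) (D `\ p)].
Proof.
move=> ML p0M p0c p0last; elim=> [|{}D u eD [p [pD pc plast IH]] act_u].
  by exists p0; split=> //; constructor.
have [uD] := and4P act_u; rewrite !inE => /andP[u1D u1L] /andP[u2D u2L] /andP[u3D u3L].
have [up|up] := eqVneq u p.
  exists (u.1.+1, u.2.+1); split.
  - by rewrite in_alpha eqxx.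
  - by rewrite /= up addSn addnS pc.
  - move=> x; rewrite in_alpha => /orP[/eqP->//|/andP[_ xD] xc] /=.
    by rewrite up ltnW // ltnS plast.
  - suff -> : alpha u D `\ (u.1.+1, u.2.+1) = D `\ p by [].
    apply/fsetP => x; rewrite !inE up; have [->|//] := eqVneq x (p.1.+1, p.2.+1).
    by rewrite -up (negPf u3D) andbF.
exists p; split.
- by rewrite in_alpha pD andbT [p == u]eq_sym up orbT.
- by [].
- move=> x; rewrite in_alpha => /orP[/eqP->/= uc|/andP[_]]; last exact: plast.
  have uc' : u.2 + c.1 = c.2 + u.1 by move: uc; rewrite addSn addnS => -[].
  rewrite ltn_neqAle (plast _ uD uc') andbT; apply: contraNneq up => e.
  exact/eqP/(diag_eq uc' pc).
- have -> : alpha u D `\ p = alpha u (D `\ p).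
    apply/fsetP => x; rewrite !inE; have [->|//] := eqVneq x (u.1.+1, u.2.+1).
      by rewrite /= andbT; apply/negP => /eqP u3p; rewrite u3p pD in u3D.
    by rewrite /=; case: (x == p); rewrite ?andbF.
  apply: exc_move => //; apply: act_corner act_u.
  + by move=> v _ vD; rewrite !inE negb_and vD orbT.
  + by rewrite !inE up.
  + apply/eqP => u3c; have pL : p \in L by apply: (fsubsetP (exc_sub ML eD)).
    have uc : u.2 + c.1 = c.2 + u.1 by rewrite -u3c /= addSnnS.
    have := plast u uD uc; rewrite leq_eqVlt => /orP[/eqP e|lt_up].
      by case/eqP: up; apply: (diag_eq uc pc).
    have c_p : c.1 <= p.1 by rewrite -u3c.
    have pE : p = c.
      rewrite [p]surjective_pairing; apply: (corner_max Ly cL) => //.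
        by rewrite -surjective_pairing.
      by rewrite -(leq_add2r c.1) pc leq_add2l.
    by move: u3D; rewrite u3c -pE pD.
Qed.

Lemma exc_rem_corner M D p0 : M `<=` L ->
    p0 \in M -> p0.2 + c.1 = c.2 + p0.1 ->
    (forall x, x \in M -> x.2 + c.1 = c.2 + x.1 -> x.1 <= p0.1) ->
    exc L M D -> c \in D -> exc (L `\ c) (M `\ p0) (D `\ c).
Proof.
move=> ML p0M p0c p0last eD cD.
have [p [pD pc plast ep]] := exc_last ML p0M p0c p0last eD.
suff pE : p = c by rewrite -[in X in D `\ X]pE.
have pL : p \in L by apply: (fsubsetP (exc_sub ML eD)).
have := plast c cD erefl; move: pc pL; case: (p) => i j /= pc pL le_c.
by apply: (corner_max Ly cL) => //; lia.
Qed.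

(** The converse of [exc_rem_corner]. First [p0] slides along its diagonal to [c]: its way is free
    because no other cell of [M] lies weakly below and to the right of [p0]. Then the moves leading
    to [D] are replayed. *)
Lemma exc_add_corner M D p0 : M `<=` L -> is_young M -> corner M p0 ->
    p0.2 + c.1 = c.2 + p0.1 ->
  exc (L `\ c) (M `\ p0) D -> exc L M (c |` D).
Proof.
move=> ML My p0M p0c; have [p0in downM rightM] := p0M.
have [cL' _ _] := cL.
have p0_le : p0.1 <= c.1.
  rewrite leqNgt; apply/negP => lt_c; have p0L := fsubsetP ML _ p0in.
  have p0E : p0 = c.
    by move: lt_c p0L p0c; case: (p0) => i j /= lt_c ijL d;
      apply: (corner_max Ly cL) => //=; lia.
  by rewrite p0E ltnn in lt_c.
have cM : c \notin M `\ p0.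
  rewrite !inE negb_and negbK; have [//|cp0 /=] := eqVneq c p0.
  apply: contraNN downM; move: (My.1) p0in p0c p0_le cp0.
  case: (p0) (c) => i j [r s] /= pos ijM d le_ir ne rsM.
  have [i0 j0] := pos _ _ ijM.
  have lt_ir : i < r.
    rewrite ltn_neqAle le_ir andbT; apply: contraNneq ne => e.
    by apply/eqP; congr (_, _); lia.
  by apply: My.2 rsM _ _; lia.
have DL D' : exc (L `\ c) (M `\ p0) D' -> D' `<=` L `\ c.
  apply: exc_sub; apply/fsubsetP => x xM; rewrite 2!inE.
  by move: (xM); rewrite !inE => /andP[_ /(fsubsetP ML)->]; rewrite andbT;
    apply: contraNneq cM => <-.
have out i j : p0.1 <= i -> p0.2 <= j -> (i, j) \notin M `\ p0.
  move=> le_i le_j; rewrite !inE negb_and negbK; case: (boolP ((i, j) \in M)) => [ijM|].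
    by rewrite (corner_max My p0M ijM) // eqxx.
  by rewrite orbT.
have base : exc L M (c |` M `\ p0).
  have slide m : p0.1 + m <= c.1 -> exc L M ((p0.1 + m, p0.2 + m) |` M `\ p0).
    elim: m => [|m IH le_c].
      by rewrite !addn0 -surjective_pairing fsetD1K //; constructor.
    have -> : (p0.1 + m.+1, p0.2 + m.+1) |` M `\ p0 =
        alpha (p0.1 + m, p0.2 + m) ((p0.1 + m, p0.2 + m) |` M `\ p0).
      apply/fsetP => x; rewrite in_alpha !inE -!addnS.
      have [//|_ /=] := eqVneq x (p0.1 + m.+1, p0.2 + m.+1).
      have [->|//] := eqVneq x (p0.1 + m, p0.2 + m).
      by have := out _ _ (leq_addr m p0.1) (leq_addr m p0.2); rewrite !inE => /negPf->.
    apply: exc_move; first by apply: IH; lia.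
    have inL i j : p0.1 <= i <= c.1 -> p0.2 <= j <= c.2 -> (i, j) \in L.
      have [] := My.1 p0.1 p0.2; first by rewrite -surjective_pairing.
      by move=> *; apply: (Ly.2 c.1 c.2); rewrite -?surjective_pairing //; lia.
    have outM i j := out i j.
    have target i j : p0.1 + m < i <= c.1 -> p0.2 + m <= j <= c.2 ->
        (i, j) \in L `\` ((p0.1 + m, p0.2 + m) |` M `\ p0).
      move=> lei lej; rewrite inE inL ?andbT; [|lia|lia].
      rewrite in_fset1U negb_or outM ?andbT; [|lia|lia].
      by apply/eqP => -[]; lia.
    have target' : (p0.1 + m, (p0.2 + m).+1) \in L `\` ((p0.1 + m, p0.2 + m) |` M `\ p0).
      rewrite inE inL ?andbT; [|lia|lia].
      rewrite in_fset1U negb_or outM ?andbT; [|lia|lia].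
      by apply/eqP => -[]; lia.
    apply/and4P; split;
      [by rewrite !inE eqxx | apply: target => /= | exact: target' | apply: target =>
        /=]; lia.
  have := slide (c.1 - p0.1);
    suff -> : (p0.1 + (c.1 - p0.1), p0.2 + (c.1 - p0.1)) = c by apply; lia.
  by move: p0c p0_le; case: (p0) (c) => i j [r s] /= *; congr (_, _); lia.
elim=> [//|{}D u eD IH /and4P[uD]].
rewrite !inE => /and3P[u1D u1c u1L] /and3P[u2D u2c u2L] /and3P[u3D u3c u3L].
have uc : u != c by have := fsubsetP (DL _ eD) _ uD; rewrite !inE => /andP[].
have -> : c |` alpha u D = alpha u (c |` D).
  apply/fsetP => x; rewrite !inE.
  by have [->|//] := eqVneq x c; rewrite [c == u]eq_sym (negPf uc) /= orbT.
apply: exc_move => //; apply/and4P.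
by rewrite !inE !negb_or u1D u1c u1L u2D u2c u2L u3D u3c u3L uD orbT.
Qed.
End Corner.
End GenericExcited.

(** * Diagrams, horizontal strips and corners of bead sets *)

Section Shapes.
Variables n N : nat.
Implicit Types A B : {set 'I_N}.
Local Open Scope fset_scope.
Local Open Scope nat_scope.

(* The Young diagram whose i-th row has length p - n + i, where p is the i-th *)
(* largest element of A, for A of cardinality n.                              *)
Definition dg A : {fset nat * nat} :=
  [fset u in [seq (i, j) | i <- iota 1 n, j <- iota 1 N]
     | u.1 <= ht A (n + u.2 - u.1)].

Lemma mem_dg A i j : #|A| = n ->
  ((i, j) \in dg A) = [&& 0 < i, 0 < j & i <= ht A (n + j - i)].
Proof.
move=> An; rewrite !inE /=; case le_i: (i <= _); rewrite ?andbF ?andbT //.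
apply/allpairsP/andP => [[[i' j'] /= [+ + [-> ->]]]|[i0 j0]].
  by rewrite !mem_iota; lia.
exists (i, j) => /=; split=> //; rewrite mem_iota; first last.
  by have := ht_leq A (n + j - i); have := ht_card A (n + j - i); lia.
by have := ht_card A (n + j - i); lia.
Qed.

Lemma dg_row A i j : #|A| = n -> (i, j) \in dg A -> i <= n.
Proof.
move=> An; rewrite mem_dg // => /and3P[_ _].
by have := ht_card A (n + j - i); lia.
Qed.

Lemma dg_young A : #|A| = n -> is_young (dg A).
Proof.
move=> An; split=> [i j|i j i' j' ijA]; first by rewrite mem_dg // => /and3P[].
have := dg_row An ijA; move: ijA; rewrite !mem_dg // => /and3P[i0 j0 le_i] i_n.
move=> /andP[i'0 le_i'] /andP[j'0 le_j']; rewrite i'0 j'0 /=.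
have [le_p|lt_p] := leqP (n + j' - i') (n + j - i).
  by have := ht_subn A (n + j' - i') (n + j - i - (n + j' - i')); rewrite subnKC //;
    lia.
have := ht_subn A (n + j - i) (n + j' - i' - (n + j - i)); rewrite subnKC; lia.
Qed.

Lemma dg_sub A B : #|A| = n -> #|B| = n ->
  reflect (forall p, ht A p <= ht B p) (dg A `<=` dg B).
Proof.
move=> An Bn; apply: (iffP (@fsubsetP _ (dg A) (dg B))) => [AB p|AB [i j]]; last first.
  by rewrite !mem_dg // => /and3P[-> -> /leq_trans->].
rewrite leqNgt; apply/negP => lt_p.
have := ht_geq B p; rewrite Bn => geB.
have hn : ht A p <= n by rewrite -An ht_card.
(* The last cell of [dg n A] on the diagonal of [p]; it is too low to belong to [dg n B]. *)
have := AB (ht A p, p + ht A p - n); rewrite !mem_dg //.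
have -> : n + (p + ht A p - n) - ht A p = p by lia.
by rewrite leqnn; move=> /(_ ltac:(lia)) /and3P[]; lia.
Qed.

Lemma dg_inj A B : #|A| = n -> #|B| = n -> dg A = dg B -> A = B.
Proof.
move=> An Bn AB; apply: ht_inj => p; apply/eqP; rewrite eqn_leq.
by apply/andP; split; move: p; apply/dg_sub; rewrite // AB.
Qed.

Lemma hstrip_dgP A B : #|A| = n -> #|B| = n ->
  reflect (dg A `<=` dg B /\ forall i j, 0 < i -> (i.+1, j) \in dg B -> (i, j) \in dg A)
          (hstrip A B).
Proof.
move=> An Bn; apply: (iffP (hstripP A B)) => [hAB|[/dg_sub hAB col] p].
  split; first by apply/dg_sub => // p; case/andP: (hAB p).
  move=> i j i0 ijB; have i_n := dg_row Bn ijB.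
  move: ijB; rewrite !mem_dg // i0 => /and3P[_ -> le_i] /=.
  have := hAB (n + j - i.+1); have -> : (n + j - i.+1).+1 = n + j - i by lia.
  by lia.
rewrite hAB //= leqNgt; apply/negP => lt_p.
have hn : ht B p <= n by rewrite -Bn ht_card.
have geA := ht_geq A p.+1; rewrite An in geA.
have := col (ht B p).-1 (p + ht B p - n) ltac:(lia).
rewrite prednK ?(leq_trans _ lt_p) // !mem_dg //.
have -> : n + (p + ht B p - n) - ht B p = p by lia.
have -> : n + (p + ht B p - n) - (ht B p).-1 = p.+1 by lia.
by rewrite leqnn => /(_ ltac:(lia)) /and3P[]; lia.
Qed.

Section DgCorner.
Variables (a b : 'I_N) (A : {set 'I_N}).
Hypotheses (ab : b.+1 = a :> nat) (An : #|A| = n) (aA : a \in A) (bA : b \notin A).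

(** The end of the row whose bead is [a]; it is a corner because the position below [a] is a
    hole. *)
Definition dg_cell := (ht A a, ht A a + a - n).

Lemma dg_cellE : [/\ 0 < dg_cell.1 <= n, 0 < dg_cell.2, n + dg_cell.2 = a + dg_cell.1,
  ht A b = dg_cell.1 & ht A a.+1 = dg_cell.1.-1].
Proof.
have := ht_a a A; have := ht_b ab A; rewrite aA (negPf bA) /dg_cell /=.
have := ht_geq A b; have := ht_card A a; rewrite An; move: ab.
by move=> ? ? ? ? ?; split; lia.
Qed.

Lemma dg_corner : corner (dg A) dg_cell.
Proof.
have [c1 c2 cE hb ha1] := dg_cellE; rewrite /corner !mem_dg //=.
have -> : n + dg_cell.2 - dg_cell.1 = a by lia.
have -> : n + dg_cell.2 - dg_cell.1.+1 = b by move: ab; lia.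
have -> : n + dg_cell.2.+1 - dg_cell.1 = a.+1 by lia.
have e1 : ht A a = dg_cell.1 by []; have e2 : ht A a + a - n = dg_cell.2 by [].
by rewrite hb ha1 leqnn; split; lia.
Qed.

Lemma dg_sw : dg (sw a b A) = dg A `\ dg_cell.
Proof.
have [c1 c2 cE hb ha1] := dg_cellE.
apply/fsetP => -[i j]; rewrite in_fsetD1 !mem_dg ?card_sw //.
have [pa|pa] := eqVneq (n + j - i) a; last first.
  rewrite ht_sw //; have [E|//] := eqVneq (i, j) dg_cell.
  have iE : i = dg_cell.1 by rewrite -E.
  have jE : j = dg_cell.2 by rewrite -E.
  by lia.
rewrite pa ht_swa // (negPf bA) ha1 -[ht A a]/dg_cell.1.
have -> : ((i, j) != dg_cell) = ~~ ((i == dg_cell.1) && (j == dg_cell.2)) by [].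
by lia.
Qed.
End DgCorner.
End Shapes.

(** * Height functions of excited diagrams *)

Section YoungHeights.
Local Open Scope fset_scope.
Local Open Scope nat_scope.
Implicit Types (D L : {fset nat * nat}).

(* The number of cells of D on the diagonal of (i, j), weakly above it, plus  *)
(* the height i - j of this diagonal on the left border when j <= i. When D   *)
(* is an excited diagram, its values along a path of lattice points describe  *)
(* the shape cut out of D by this path.                                       *)
Fixpoint Yh D i j : nat :=
  match i, j with
  | 0, _ => 0
  | i'.+1, 0 => i
  | i'.+1, j'.+1 => Yh D i' j' + ((i, j) \in D)
  end.

(** The excited array read off from [D] alone: it marks the cells along whose top edge the height
    drops. *)
Definition arr D (u : nat * nat) : bool := Yh D u.1.-1 u.2 < Yh D u.1.-1 u.2.-1.

Lemma Yh0 D i : Yh D i 0 = i. Proof. by case: i. Qed.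

Lemma YhS D i j : Yh D i.+1 j.+1 = Yh D i j + ((i.+1, j.+1) \in D).
Proof. by []. Qed.

Lemma eq_Yh D D' i j :
    (forall i' j', i' <= i -> j' <= j -> ((i', j') \in D) = ((i', j') \in D')) ->
  Yh D i j = Yh D' i j.
Proof.
elim: i j => [|i IH] [|j] //= DD'; rewrite (IH j) ?DD' //.
by move=> i' j' le_i le_j; apply: DD'; apply: ltnW.
Qed.

(** The moved cell stays on its diagonal, so the count changes only at the lattice point [u]. *)
Lemma Yh_alpha D u i j : 0 < u.1 -> 0 < u.2 -> u \in D ->
  (u.1.+1, u.2.+1) \notin D -> Yh (alpha u D) i j + ((i, j) == u) = Yh D i j.
Proof.
move=> u1 u2 uD u3D; elim: i j => [|i IH] [|j] /=.
- by rewrite (_ : (0, 0) == u = false) //; apply/eqP => uE; rewrite -uE in u1.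
- by rewrite (_ : (0, j.+1) == u = false) //; apply/eqP => uE; rewrite -uE in u1.
- by rewrite (_ : (i.+1, 0) == u = false) ?addn0 //; apply/eqP => uE; rewrite -uE in u2.
rewrite -IH in_alpha; have [uE|uE] := eqVneq (i.+1, j.+1) u.
  have -> : (i, j) == u = false.
    by rewrite -uE; apply/eqP => -[]; lia.
  have -> : (i.+1, j.+1) == (u.1.+1, u.2.+1) = false.
    by rewrite -uE; apply/eqP => -[]; lia.
  by rewrite uE uD /= !addn0.
have -> : (i.+1, j.+1) == (u.1.+1, u.2.+1) = ((i, j) == u).
  by case: (u).
have [ijE|_] := eqVneq (i, j) u; last by rewrite !addn0.
by move: u3D; rewrite -ijE /= => /negPf->; rewrite !addn0.
Qed.

Global Arguments Yh : simpl never.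

Lemma Yh_dg n N (A : {set 'I_N}) i j : #|A| = n -> i <= n ->
  Yh (dg n A) i j = minn i (ht A (n + j - i)).
Proof.
move=> An; elim: i j => [|i IH] [|j] i_n; rewrite ?min0n //.
  by have := ht_geq A (n + 0 - i.+1); rewrite An Yh0; lia.
rewrite YhS IH; last by lia.
rewrite mem_dg // !ltn0Sn /=; have -> : n + j.+1 - i.+1 = n + j - i by lia.
by lia.
Qed.

Section Invariant.
Variables (n N : nat) (L : {fset nat * nat}) (A : {set 'I_N}).
Hypothesis Ln : forall i j, (i, j) \in L -> i <= n.

(** The last clause holds because moves stay inside [L]: on and beyond its outer border all cells of
    a diagonal are counted, and their number never changes. *)
Definition height_inv D : Prop :=
  [/\ forall i j, i <= n -> Yh D i j.+1 <= Yh D i j <= (Yh D i j.+1).+1,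
      forall i j, i < n -> Yh D i j <= Yh D i.+1 j <= (Yh D i j).+1
    & forall i j, i <= n -> (i.+1, j.+1) \notin L -> Yh D i j = ht A (n + j - i)].

(** The cell of [D] raises the height along its own diagonal step, the free neighbours keep it along
    theirs, and the bounds on unit steps leave one possibility. *)
Lemma act_heights D i j : height_inv D -> D `<=` L -> act L D (i.+1, j.+1) ->
  [/\ i.+1 < n, Yh D i.+1 j.+1 = (Yh D i j).+1, Yh D i j.+1 = Yh D i j,
      Yh D i.+1 j = (Yh D i j).+1 &
      Yh D i.+1 j.+2 = Yh D i j /\ Yh D i.+2 j.+1 = (Yh D i j).+1].
Proof.
move=> [I1 I2 _] DL /and4P[uD]; rewrite !inE /=.
move=> /andP[u1D u1L] /andP[u2D u2L] /andP[u3D u3L].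
have i_n := Ln u1L.
have := I1 i j ltac:(lia); have := I1 i.+1 j ltac:(lia).
have := I2 i j ltac:(lia); have := I2 i j.+1 ltac:(lia).
rewrite !YhS uD (negPf u1D) (negPf u2D) => *.
have E : Yh D i j.+1 = Yh D i j by lia.
have E' : Yh D i.+1 j = (Yh D i j).+1 by lia.
by rewrite E E' !addn0 addn1; split.
Qed.

Hypotheses (An : #|A| = n) (Ly : is_young L) (AL : dg n A `<=` L).

Lemma height_inv_dg : height_inv (dg n A).
Proof.
split=> i j i_n.
- rewrite !Yh_dg //; have := ht_step A (n + j - i).
  by rewrite -(_ : n + j.+1 - i = (n + j - i).+1); lia.
- rewrite !Yh_dg ?(ltnW i_n) //; have := ht_step A (n + j - i.+1).
  by rewrite (_ : (n + j - i.+1).+1 = n + j - i); lia.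
move=> ijL; rewrite Yh_dg //; have : (i.+1, j.+1) \notin dg n A.
  by apply: contraNN ijL; apply: (fsubsetP AL).
rewrite mem_dg //= -leqNgt (_ : n + j.+1 - i.+1 = n + j - i); lia.
Qed.

Lemma height_inv_alpha D u : height_inv D -> D `<=` L -> act L D u ->
  height_inv (alpha u D).
Proof.
case: u => i0 j0 inv DL act_u.
have [uD _ _] := and4P act_u; rewrite !inE /= => /andP[u3D u3L].
have [i00 j00] := Ly.1 _ _ (fsubsetP DL _ uD).
case: i0 j0 i00 j00 act_u uD u3D u3L => [//|i0] [//|j0] _ _ act_u uD u3D u3L.
have [i0n e1 e2 e3 [e4 e5]] := act_heights inv DL act_u.
have YE i j : Yh (alpha (i0.+1, j0.+1) D) i j = Yh D i j - ((i, j) == (i0.+1, j0.+1)).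
  by rewrite -(@Yh_alpha D (i0.+1, j0.+1)) // addnK.
case: inv => I1 I2 I3; split=> i j i_n.
- have := I1 i j i_n; rewrite !YE !xpair_eqE eqSS.
  case: (eqVneq i i0.+1) => [->|_] /=; last by rewrite !subn0.
  case: (eqVneq j j0.+1) => [->|_]; first by rewrite (gtn_eqF (ltnSn _)) e1 e4; lia.
  by case: (eqVneq j j0) => [->|_]; rewrite ?e1 ?e3; lia.
- have := I2 i j i_n; rewrite !YE !xpair_eqE eqSS.
  case: (eqVneq j j0.+1) => [->|_]; rewrite ?andbF ?subn0 // !andbT.
  case: (eqVneq i i0.+1) => [->|_]; first by rewrite (gtn_eqF (ltnSn _)) e1 e5; lia.
  by case: (eqVneq i i0) => [->|_]; rewrite ?e1 ?e2; lia.
move=> ijL; rewrite YE I3 //; case: eqP => [[iE jE]|_]; last by rewrite subn0.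
by rewrite iE jE u3L in ijL.
Qed.

Lemma exc_height_inv D : exc L (dg n A) D -> height_inv D.
Proof.
elim=> [|{}D u eD IH]; first exact: height_inv_dg.
by apply: height_inv_alpha => //; apply: exc_sub eD.
Qed.

End Invariant.
End YoungHeights.

(** * Sums over excited diagrams *)

Section ExcitedSum.
Variables (R : comUnitRingType) (n N : nat) (w : nat * nat -> R).
Local Open Scope ring_scope.
Local Open Scope fset_scope.
Local Open Scope nat_scope.
Implicit Types (L M S T D : {fset nat * nat}) (A la : {set 'I_N}).

Definition exc_fset L M : {fset {fset nat * nat}} :=
  [fset S in fpowerset L | `[< exc L M S >]].

Lemma exc_fsetP L M S : M `<=` L -> reflect (exc L M S) (S \in exc_fset L M).
Proof.
move=> ML; rewrite !inE; apply: (iffP andP) => [[_ /asboolP //]|eS].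
by split; [rewrite fpowersetE; apply: exc_sub eS | apply/asboolP].
Qed.

Global Arguments exc_fsetP {L M S}.

Definition exc_term L S : R :=
  ((\prod_(v <- L) w v ^+ arr S v) * \prod_(v <- L `\` S) (1 - w v)^-1)%R.

Definition exc_sum L M : R := (\sum_(S <- exc_fset L M) exc_term L S)%R.

Definition Gsum la A : R :=
  if (#|A| == n) && (dg n A `<=` dg n la) then exc_sum (dg n la) (dg n A) else 0%R.

Lemma arr_in L A D v : #|A| = n -> is_young L -> dg n A `<=` L ->
    (forall i j, (i, j) \in L -> i <= n) ->
  exc L (dg n A) D -> v \in D -> arr D v = false.
Proof.
move=> An Ly AL Ln eD vD; have [I1 I2 _] := exc_height_inv Ln An Ly AL eD.
have vL := fsubsetP (exc_sub AL eD) _ vD.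
move: vL vD; case: v => i j vL vD; have := Ly.1 _ _ vL.
case: i j vL vD => [|i] [|j] vL vD [] // _ _; rewrite /arr /=.
have := Ln _ _ vL => i_n; have := I1 i j ltac:(lia); have := I2 i j.+1 i_n.
by rewrite YhS vD; lia.
Qed.

Section Corner.
Variables (a b : 'I_N) (la : {set 'I_N}).
Hypotheses (ab : b.+1 = a :> nat) (lan : #|la| = n) (ala : a \in la) (bla : b \notin la).
Let L := dg n la.
Let c := dg_cell n a la.

Let Ly : is_young L. Proof. exact: dg_young. Qed.
Let cL : corner L c. Proof. exact: (dg_corner ab). Qed.
Let cP : [/\ 0 < c.1 <= n, 0 < c.2 & n + c.2 = a + c.1].
Proof. by have [? ? ? _ _] := dg_cellE ab lan ala bla. Qed.
Let Ln i j : (i, j) \in L -> i <= n. Proof. exact: dg_row. Qed.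

(** These are the vertices of the corner cell other than its upper left one. They lie on the outer
    border, where the heights do not depend on [D]. *)
Lemma exc_heights_corner A D : #|A| = n -> dg n A `<=` L -> exc L (dg n A) D ->
  [/\ ht A a.+1 = Yh D c.1.-1 c.2, ht A a = Yh D c.1 c.2
    & ht A b = Yh D c.1 c.2.-1].
Proof.
move=> An AL eD; have [_ _ I3] := exc_height_inv Ln An Ly AL eD.
have [c1 c2 cE] := cP.
have [cin downL rightL] := cL.
have noDR : (c.1.+1, c.2.+1) \notin L.
  by apply: contraNN downL => c3; apply: (Ly.2 _ _ _ _ c3); lia.
have [c1' cn] := andP c1; split.
- rewrite I3 ?prednK //; last by lia.
  by congr (ht A _); lia.
- by rewrite I3 //; congr (ht A _); lia.
rewrite I3 ?prednK //; congr (ht A _); move: ab; lia.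
Qed.

Lemma arr_corner A D : #|A| = n -> dg n A `<=` L -> exc L (dg n A) D ->
  c \notin D -> arr D c = (a \in A).
Proof.
move=> An AL eD cD; have [ha1 ha _] := exc_heights_corner An AL eD.
have [/andP[c1 _] c2 _] := cP.
have YE : Yh D c.1 c.2 = Yh D c.1.-1 c.2.-1.
  rewrite -[in LHS](prednK c1) -[in LHS](prednK c2) YhS !prednK //.
  by rewrite -surjective_pairing (negPf cD) addn0.
rewrite /arr -ha1 -YE -ha ht_a; case: (a \in A); lia.
Qed.

Lemma exc_corner_outer A D : #|A| = n -> dg n A `<=` L -> exc L (dg n A) D ->
  c \in D -> (a \in A) && (b \notin A).
Proof.
move=> An AL eD cD; have [ha1 ha hb] := exc_heights_corner An AL eD.
have [I1 I2 _] := exc_height_inv Ln An Ly AL eD.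
have [/andP[c1 cn] c2 _] := cP.
have YE : Yh D c.1 c.2 = (Yh D c.1.-1 c.2.-1).+1.
  rewrite -[in LHS](prednK c1) -[in LHS](prednK c2) YhS !prednK //.
  by rewrite -surjective_pairing cD addn1.
have c1n : c.1.-1 < n by rewrite prednK.
have := arr_in An Ly AL Ln eD cD; rewrite /arr -ha1.
have := I1 c.1.-1 c.2.-1 (ltnW c1n); have := I2 c.1.-1 c.2.-1 c1n.
have := I2 c.1.-1 c.2 c1n; have := I1 c.1 c.2.-1 cn.
rewrite !prednK // -ha1 -hb -ha.
by have := ht_a a A; have := ht_b ab A; case: (a \in A); case: (b \in A); lia.
Qed.

(** [arr] at [v] reads only cells in higher rows and in columns up to that of [v]; the corner [c] is
    not among them. *)
Lemma arr_add_corner T v : v \in L `\ c -> arr (c |` T) v = arr T v.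
Proof.
rewrite in_fsetD1 => /andP[vc vL].
suff YE j : j <= v.2 ->
  Yh (c |` T) v.1.-1 j = Yh T v.1.-1 j by rewrite /arr !YE ?leq_pred.
move=> le_j; apply: eq_Yh => i' j' lei' lej'; rewrite in_fset1U.
case: eqP => //= cE; case/eqP: vc.
have := Ly.1 v.1 v.2; rewrite -surjective_pairing => /(_ vL) [v1 _].
have [c1 c2] : c.1 = i' /\ c.2 = j' by rewrite -cE.
rewrite [v]surjective_pairing; apply: (corner_max Ly cL).
- by rewrite -surjective_pairing.
- by rewrite c1; lia.
by rewrite c2; lia.
Qed.

Lemma exc_term_notin A D : #|A| = n -> dg n A `<=` L -> exc L (dg n A) D ->
  c \notin D ->
  exc_term L D = (w c ^+ (a \in A) * (1 - w c)^-1 * exc_term (L `\ c) D)%R.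
Proof.
move=> An AL eD cD; have [cin _ _] := cL; rewrite /exc_term.
rewrite (big_fsetD1 c) //= [X in (_ * X)%R](big_fsetD1 c) /= ?in_fsetD ?cD ?cin //.
rewrite (arr_corner An AL eD cD) mulrACA; congr (_ * (_ * _))%R.
by rewrite fsetDDl fsetUC -fsetDDl.
Qed.

Lemma exc_term_in A D : #|A| = n -> dg n A `<=` L -> exc L (dg n A) (c |` D) ->
  exc_term L (c |` D) = exc_term (L `\ c) D.
Proof.
move=> An AL eD; have [cin _ _] := cL; rewrite /exc_term.
rewrite (big_fsetD1 c) //= (arr_in An Ly AL Ln eD) ?fset1U1 // mul1r fsetDDl.
by congr (_ * _)%R; apply: eq_big_seq => v /arr_add_corner->.
Qed.

Lemma dg_sub_sw A : #|A| = n -> a \in A -> b \notin A ->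
  (dg n (sw a b A) `<=` L `\ c) = (dg n A `<=` L).
Proof.
move=> An aA bA; rewrite -(dg_sw ab lan) // -/L; apply/dg_sub/dg_sub;
  rewrite ?card_sw // => h p.
  have := h p; have [->|pa] := eqVneq p a; last by rewrite !ht_sw.
  by rewrite !ht_swa // !ht_a (negPf bA) (negPf bla) aA ala.
have := h p; have [->|pa] := eqVneq p a; last by rewrite !ht_sw.
by rewrite !ht_swa // !ht_a (negPf bA) (negPf bla) aA ala.
Qed.

Lemma exc_sum_notin A : #|A| = n -> dg n A `<=` L ->
  (\sum_(S <- exc_fset L (dg n A) | c \notin S) exc_term L S =
   w c ^+ (a \in A) * (1 - w c)^-1 * Gsum (sw a b la) A)%R.
Proof.
move=> An AL; rewrite /Gsum An eqxx (dg_sw ab lan) // -/L -/c /=.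
have [cin _ _] := cL.
case: ifPn => ALc; last first.
  rewrite mulr0 big_seq_cond big1 // => S /andP[/(exc_fsetP AL) eS].
  rewrite (exc_mem_corner cL _ eS) //; apply: contraNT ALc => cA.
  by rewrite fsubsetD1 AL.
rewrite /exc_sum mulr_sumr [LHS]big_fset_condE /=.
have -> : [fset S in exc_fset L (dg n A) | c \notin S] = exc_fset (L `\ c) (dg n A).
  apply/fsetP => S; apply/idP/(exc_fsetP ALc) => [|eS].
    by rewrite 2!inE /= => /andP[/(exc_fsetP AL) eS cS]; apply: exc_notin_corner.
  rewrite 2!inE /=; apply/andP; split; first by apply/(exc_fsetP AL);
    apply: exc_corner eS.
  by have := exc_sub ALc eS; rewrite fsubsetD1 => /andP[].
rewrite big_seq [RHS]big_seq; apply: eq_bigr => S /(exc_fsetP ALc) eS.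
rewrite (exc_term_notin An AL) //; first exact: exc_corner eS.
by have := exc_sub ALc eS; rewrite fsubsetD1 => /andP[].
Qed.

Lemma exc_sum_in A : #|A| = n -> dg n A `<=` L ->
  (\sum_(S <- exc_fset L (dg n A) | c \in S) exc_term L S =
   ((a \in A) && (b \notin A))%:R * Gsum (sw a b la) (sw a b A))%R.
Proof.
move=> An AL; case: (boolP ((a \in A) && (b \notin A))) => [/andP[aA bA]|outA];
  last first.
  rewrite mul0r big_seq_cond big1 // => S /andP[/(exc_fsetP AL) eS cS].
  by rewrite (exc_corner_outer An AL eS cS) in outA.
rewrite mul1r /Gsum card_sw // An eqxx (dg_sw ab lan) // -/L -/c dg_sub_sw // AL /=.
have AL' : dg n (sw a b A) `<=` L `\ c by rewrite dg_sub_sw.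
have [cin _ _] := cL; have [_ _ cE] := cP.
have p0A := dg_corner ab An aA bA; set p0 := dg_cell n a A in p0A.
have [_ _ p0E _ _] := dg_cellE ab An aA bA; rewrite -/p0 in p0E.
have p0c : p0.2 + c.1 = c.2 + p0.1 by lia.
have p0last x : x \in dg n A -> x.2 + c.1 = c.2 + x.1 -> x.1 <= p0.1.
  move=> xA xc; rewrite leqNgt; apply/negP => lt_x.
  suff xE : x = p0 by rewrite xE ltnn in lt_x.
  move: xA xc lt_x; case: x => i j /= xA xc lt_x.
  by apply: (corner_max (dg_young An) p0A) => //=; lia.
rewrite /exc_sum (dg_sw ab An) // -/p0 [LHS]big_fset_condE /=.
have p0in : p0 \in dg n A by case: p0A.
(* Adding [c] is a bijection from the excited diagrams of the pair with both corners removed. *)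
have -> : [fset S in exc_fset L (dg n A) | c \in S] =
    [fset c |` T | T in exc_fset (L `\ c) (dg n A `\ p0)].
  rewrite -(dg_sw ab An) //; apply/fsetP => S;
    apply/idP/imfsetP => /= [|[T /(exc_fsetP AL')]].
    rewrite 2!inE /= => /andP[/(exc_fsetP AL) eS cS]; exists (S `\ c);
      last by rewrite fsetD1K.
    apply/(exc_fsetP AL'); rewrite (dg_sw ab An) //; exact: exc_rem_corner eS cS.
  rewrite (dg_sw ab An) // => eT ->; rewrite 2!inE /= fset1U1 andbT.
  by apply/(exc_fsetP AL); apply: (exc_add_corner _ cL AL (dg_young An) p0A).
rewrite -(dg_sw ab An) // big_imfset /=; last first.
  move=> S T /(exc_fsetP AL') /(exc_sub AL') + /(exc_fsetP AL') /(exc_sub AL').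
  rewrite !fsubsetD1 => /andP[_ cS] /andP[_ cT] /(congr1 (fun X => X `\ c)).
  by rewrite !fsetU1K.
rewrite big_seq [RHS]big_seq; apply: eq_bigr => S /(exc_fsetP AL').
rewrite (dg_sw ab An) // => eS; apply: (exc_term_in An AL).
by apply: (exc_add_corner _ cL AL (dg_young An) p0A).
Qed.

Lemma Gsum_corner A : ((1 - w c) \is a GRing.unit)%R ->
  ((1 - w c) * Gsum la A = w c ^+ (a \in A) * Gsum (sw a b la) A +
   (1 - w c) * ((a \in A) && (b \notin A))%:R * Gsum (sw a b la) (sw a b A))%R.
Proof.
move=> w1; have [An|An] := eqVneq #|A| n; last first.
  by rewrite /Gsum card_sw // (negPf An) /= !mulr0 addr0.
case: (boolP (dg n A `<=` L)) => AL.
  rewrite {1}/Gsum An eqxx AL /= /exc_sum (bigID (fun S => c \in S)) /=.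
  rewrite exc_sum_in // exc_sum_notin // mulrDr addrC mulrA; congr (_ + _)%R.
    by rewrite mulrCA mulrV // mulr1.
  by rewrite mulrA.
have ALc : (dg n A `<=` L `\ c) = false.
  by apply/negbTE; apply: contraNN AL => /fsubset_trans; apply; apply: fsubD1set.
rewrite {1}/Gsum (negPf AL) andbF mulr0 /Gsum (dg_sw ab lan) // -/L -/c ALc andbF mulr0 add0r.
case: (boolP ((a \in A) && (b \notin A))) => [/andP[aA bA]|_];
  last by rewrite mulr0 mul0r.
by rewrite dg_sub_sw // (negPf AL) andbF mulr0.
Qed.
End Corner.
End ExcitedSum.

(** * The Pieri rule for sums over excited diagrams *)

Section Pieri.
Variables (R : comUnitRingType) (n N : nat) (w : nat * nat -> R).
Local Open Scope ring_scope.
Local Open Scope fset_scope.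
Local Open Scope nat_scope.
Implicit Types (A B la : {set 'I_N}) (Z : 'I_N -> R).

Lemma Gsum_self la : #|la| = n -> Gsum n w la la = 1%R.
Proof.
move=> lan; rewrite /Gsum lan eqxx fsubset_refl /= /exc_sum.
have eS S : exc (dg n la) (dg n la) S -> S = dg n la.
  by elim=> // {}S u _ -> /and4P[_ _ _]; rewrite inE => /andP[/negPf->].
have -> : exc_fset (dg n la) (dg n la) = [fset dg n la].
  apply/fsetP => S; rewrite in_fset1; have sub := fsubset_refl (dg n la).
  by apply/(exc_fsetP sub)/eqP => [/eS//|->]; constructor.
rewrite big_seq_fset1 /exc_term fsetDv big_seq_fset0 mulr1.
rewrite big_seq big1 // => v vL.
have Ln i j : (i, j) \in dg n la -> i <= n by apply: dg_row.
by rewrite (arr_in lan (dg_young lan) (fsubset_refl _) Ln (exc_init _ _) vL).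
Qed.

(** With no bead directly above a hole, the beads fill the lowest [n] positions, which encode the
    empty partition. *)
Lemma dg_no_corner la : #|la| = n ->
    (forall a b : 'I_N, b.+1 = a :> nat -> a \in la -> b \in la) ->
  dg n la = fset0.
Proof.
move=> lan closed; apply/fsetP => -[i j]; rewrite mem_dg // inE.
apply/negP => /and3P[i0 j0]; set p := n + j - i => le_i.
have below (x : 'I_N) y : x \in la -> y <= x -> ht la y + y = n.
  elim: y => [|y IH] xla yx; first by rewrite ht0 addn0.
  have yN : y < N by apply: ltn_trans (ltn_ord x).
  have inla (z : nat) (zN : z < N) : z <= x -> Ordinal zN \in la.
    move=> zx; have [d] : exists d, z + d = x by exists (x - z); rewrite subnKC.
    elim: d z zN {zx} => [|d IHd] z zN zd.
      by have -> : Ordinal zN = x by apply: val_inj; rewrite /= -zd addn0.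
    have z1N : z.+1 < N by apply: leq_ltn_trans (ltn_ord x);
      rewrite -zd addnS ltnS leq_addr.
    by apply: (closed (Ordinal z1N)) => //; apply: IHd; rewrite addSnnS.
  have := IH xla (ltnW yx); have /= -> := htS la (Ordinal yN).
  by rewrite inla ?(ltnW yx) // add1n addSnnS.
have : 0 < ht la p by apply: leq_trans le_i.
rewrite card_gt0 => /set0Pn[x]; rewrite inE => /andP[xla px].
by have := below x p xla px; rewrite /p in le_i *; lia.
Qed.

Lemma hstrip_refl A : hstrip A A.
Proof. by apply/hstripP => p; have /andP[_ ->] := ht_step A p; rewrite leqnn. Qed.

(* Dividing by monom Z la turns the coefficients into the products of the      *)
(* diagonal weights of the cells between B and la. In this division-free form *)
(* removing a corner of la just exchanges two values of Z, whereas it would   *)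
(* invert the weight of a diagonal.                                           *)
Theorem pieri la Z : #|la| = n ->
    (forall p p' : 'I_N, p' < p -> p \in la -> p' \notin la ->
       Z p' = (w (ht la p, p'.+1 + ht la p' - n)%N * Z p)%R) ->
    (forall u, u \in dg n la -> (1 - w u)%R \is a GRing.unit) ->
  forall A, #|A| = n ->
  (monom Z la * Gsum n w la A =
   \sum_(B : {set 'I_N}) (hstrip A B)%:R * monom Z B * Gsum n w la B)%R.
Proof.
have [k] := ubnP #|` dg n la|; elim: k la Z => // k IH la Z ltk lan hZ w1 A An.
have [/existsP[a /existsP[b /and3P[/eqP ab ala bla]]]|noc] :=
  boolP [exists a : 'I_N, exists b : 'I_N, [&& b.+1 == a :> nat, a \in la & b \notin la]]; last first.
  have la0 : dg n la = fset0.
    apply: dg_no_corner => // a b ab ala; apply: contraNT noc => bla.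
    by apply/existsP; exists a; apply/existsP; exists b; rewrite ab eqxx ala.
  have GE B : Gsum n w la B = (B == la)%:R%R.
    have [->|Bla] := eqVneq B la; first exact: Gsum_self.
    rewrite /Gsum la0 fsubset0 -la0; case: eqP => //= Bn.
    by case: eqP => // /(dg_inj Bn lan) E; rewrite E eqxx in Bla.
  rewrite (bigD1 la) //= big1 => [|B /negPf Bla]; last by rewrite GE Bla mulr0.
  rewrite !GE eqxx mulr1 addr0 mulrC; congr (_ * _)%R.
  case: (boolP (hstrip A la)) => [/(hstrip_dgP An lan)[]|].
    by rewrite la0 fsubset0 -la0 => /eqP/(dg_inj An lan)-> _; rewrite eqxx.
  by have [->|//] := eqVneq A la; rewrite hstrip_refl.
have [cin _ _] := dg_corner ab lan ala bla.
have [c1 c2 cE hb ha1] := dg_cellE ab lan ala bla.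
set c := dg_cell n a la in cin c1 c2 cE hb ha1.
have w1c := w1 _ cin.
have haE : ht la a = (ht la a.+1).+1 by rewrite ht_a ala.
have Zab : Z b = (w c * Z a)%R.
  rewrite (hZ a b) //; last by rewrite -ab.
  by congr (w _ * _)%R; rewrite /c /dg_cell; congr (_, _); rewrite hb /= -/c -ab; lia.
apply: (mulrI w1c); apply: (pieri_step ab Zab (g := Gsum n w (sw a b la))) => [B|B].
  exact: Gsum_corner.
rewrite An => Bn; have := IH (sw a b la) (Z \o tperm a b).
rewrite monom_sw swK => ->; first by apply: eq_bigr => C _; rewrite monom_sw.
- by have := ltk; rewrite (dg_sw ab lan) // (cardfsD1 c) cin.
- by rewrite card_sw.
(* Cells correspond to pairs of a bead [p] and a lower hole [p']. The transposition sends the pairs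
   of the smaller shape to pairs of [la] with the same row and column, so the compatibility of [Z]
   with [w] is inherited. *)
- move=> p p' lt_p pla p'la /=.
  have pa : p != a by apply: contraNneq bla => pa; rewrite pa sw_a in pla.
  have p'b : p' != b by apply: contraNneq p'la => ->; rewrite sw_b.
  have ha'1 : ht (sw a b la) a = ht la a.+1 by rewrite ht_swa // (negPf bla).
  have tpE : ht (sw a b la) p = ht la (tperm a b p).
    by rewrite ht_sw //; have [pE|->|//] := tpermP a b p;
      [rewrite pE eqxx in pa | rewrite hb].
  have tp'E : p'.+1 + ht (sw a b la) p' = (tperm a b p').+1 + ht la (tperm a b p').
    have [->|p'E|/eqP p'a _] := tpermP a b p';
      [| by rewrite p'E eqxx in p'b | by rewrite ht_sw].
    by rewrite ha'1 hb /= -/c ab; lia.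
  rewrite !inE in pla p'la; rewrite tpE tp'E; apply: hZ => //.
  have [p'E|p'E|/eqP p'a _] := tpermP a b p'; first 1 last.
  + by rewrite p'E eqxx in p'b.
  + have [pE|pE|_ _] := tpermP a b p => //; first by rewrite pE eqxx in pa.
    by rewrite pE in lt_p; rewrite -ab ltnW // ltnS ltnW.
  have [pE|pE|_ _] := tpermP a b p; first by rewrite pE eqxx in pa.
    by rewrite p'E pE -ab ltnNge leqnSn in lt_p.
  by rewrite p'E in lt_p; apply: ltn_trans lt_p; rewrite -ab.
- by move=> u; rewrite (dg_sw ab lan) // in_fsetD1 => /andP[_ /w1].
- exact: Bn.
Qed.
End Pieri.

(** * Bead sets from row lengths *)

Section RowLengths.
Local Open Scope fset_scope.
Local Open Scope nat_scope.

Lemma count_iota_down (P : pred nat) (m j : nat) :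
    (forall i i', 0 < i' <= i -> P i -> P i') -> 0 < j <= m ->
  (j <= count P (iota 1 m)) = P j.
Proof.
move=> down /andP[j0 jm]; case: (boolP (P j)) => Pj.
  have -> : m = j + (m - j) by rewrite subnKC.
  rewrite iotaD count_cat; apply: leq_trans (leq_addr _ _).
  have /eqP -> // : count P (iota 1 j) == j.
  rewrite -{2}(size_iota 1 j) -all_count.
  by apply/allP => i; rewrite mem_iota => ij; apply: down Pj; lia.
apply/negbTE; rewrite -ltnNge.
have -> : m = j.-1 + (m - j.-1) by rewrite subnKC //; lia.
rewrite iotaD count_cat [X in _ + X](_ : _ = 0) ?addn0.
  by have := count_size P (iota 1 j.-1); rewrite size_iota; lia.
apply/eqP; rewrite -leqn0 leqNgt -has_count; apply/hasPn => i; rewrite mem_iota => ij.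
by apply: contraNN Pj; apply: down; lia.
Qed.

Variables (n N : nat) (len : nat -> nat).
Hypothesis len_down : forall i i', 0 < i' <= i -> len i <= len i'.
Hypothesis len_bound : forall i, 0 < i <= n -> len i + n <= N.

(** The beta-numbers of the partition with row lengths [len]. *)
Definition row_pos (i : 'I_n) : nat := len i.+1 + n - i.+1.

Lemma row_pos_lt i : row_pos i < N.
Proof. by have := len_bound (ltn_ord i : 0 < i.+1 <= n); have := ltn_ord i;
  rewrite /row_pos; lia. Qed.

Definition st : {set 'I_N} := [set Ordinal (row_pos_lt i) | i : 'I_n].

Lemma row_pos_anti (i i' : 'I_n) : i <= i' -> row_pos i' + (i' - i) <= row_pos i.
Proof.
move=> ii'; have := @len_down i'.+1 i.+1 ltac:(lia); have := ltn_ord i';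
  have := ltn_ord i.
by rewrite /row_pos; lia.
Qed.

Lemma row_ord_inj : injective (fun i : 'I_n => Ordinal (row_pos_lt i)).
Proof.
move=> i i' /(congr1 val) /= e; apply: val_inj => /=.
have [ii'|/ltnW ii'] := leqP i i'; have := row_pos_anti ii'; lia.
Qed.

Lemma card_st : #|st| = n.
Proof. by rewrite card_imset ?card_ord //; apply: row_ord_inj. Qed.

Lemma ht_st p : ht st p = #|[set i : 'I_n | p <= row_pos i]|.
Proof.
rewrite -(card_imset _ row_ord_inj); apply: eq_card => x; rewrite !inE.
apply/andP/imsetP => [[/imsetP[i _ ->] pi]|[i]]; first by exists i; rewrite ?inE.
by rewrite inE => pi ->; split=> //; apply: imset_f.
Qed.

Lemma ht_st_geq p (i : 'I_n) : (i < ht st p) = (p <= row_pos i).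
Proof.
rewrite ht_st; case: (leqP p (row_pos i)) => [pi|ip].
  have sub : [set k : 'I_n | k <= i] \subset [set k : 'I_n | p <= row_pos k].
    by apply/fintype.subsetP => k; rewrite !inE => /row_pos_anti; lia.
  apply: leq_trans (subset_leq_card sub).
  have -> : [set k : 'I_n | k <= i] = [set widen_ord (ltn_ord i) k | k : 'I_i.+1].
    apply/setP => k; rewrite inE; apply/idP/imsetP => [ki|[k' _ ->] /=];
      last by rewrite -ltnS.
    by exists (Ordinal (ki : k < i.+1)) => //; apply: val_inj.
  by rewrite card_imset ?card_ord // => k k' /(congr1 val) /= /val_inj.
apply/negbTE; rewrite -leqNgt.
have sub : [set k : 'I_n | p <= row_pos k] \subset [set k : 'I_n | k < i].
  apply/fintype.subsetP => k; rewrite !inE => pk; rewrite ltnNge;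
    apply/negP => /row_pos_anti; lia.
apply: leq_trans (subset_leq_card sub) _.
have -> : [set k : 'I_n | k < i] = [set widen_ord (ltnW (ltn_ord i)) k | k : 'I_i].
  apply/setP => k; rewrite inE; apply/idP/imsetP => [ki|[k' _ ->]];
    last exact: (ltn_ord k').
  by exists (Ordinal ki) => //; apply: val_inj.
by rewrite card_imset ?card_ord // => k k' /(congr1 val) /= /val_inj.
Qed.

Lemma mem_dg_st i j : ((i, j) \in dg n st) = [&& 0 < i <= n & 0 < j <= len i].
Proof.
rewrite mem_dg ?card_st //; case: i => [//|i] /=.
have [i_n|n_i] := ltnP i n; last first.
  by apply/negP => /andP[_]; have := ht_card st (n + j - i.+1); rewrite card_st; lia.
have /= -> := ht_st_geq (n + j - i.+1) (Ordinal i_n); rewrite /row_pos /=; lia.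
Qed.
End RowLengths.

Section YoungState.
Local Open Scope fset_scope.
Local Open Scope nat_scope.

Lemma young_state n N (la : {set 'I_N}) (Z : {fset nat * nat}) : #|la| = n ->
  is_young Z -> Z `<=` dg n la -> exists2 B : {set 'I_N}, #|B| = n & dg n B = Z.
Proof.
move=> lan [Z0 Zdown] Zla.
have ZN i j : (i, j) \in Z -> i <= n /\ j + n <= N.
  move=> ijZ; have := fsubsetP Zla _ ijZ => ijla; have i_n := dg_row lan ijla.
  move: ijla; rewrite mem_dg // => /and3P[i0 _].
  by have := ht_leq la (n + j - i); lia.
pose len i := count (fun j => (i, j) \in Z) (iota 1 N).
have lenP i j : ((i, j) \in Z) = (0 < j <= len i).
  have [jN|/andP] := boolP (0 < j <= N).
    rewrite -(@count_iota_down (fun j => (i, j) \in Z) N) //;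
      first by case/andP: jN => ->.
    by move=> k k' kk' ikZ; have [i0 _] := Z0 _ _ ikZ; apply: Zdown ikZ _ _; lia.
  move=> jN; apply/idP/idP => [ijZ|/andP[j0 jl]]; case: jN; split=> //.
  - by have [] := Z0 _ _ ijZ.
  - by have [] := ZN _ _ ijZ; lia.
  by apply: leq_trans jl _; rewrite /len (leq_trans (count_size _ _)) ?size_iota.
have len_down i i' : 0 < i' <= i -> len i <= len i'.
  move=> ii'; case e: (len i) => [//|l].
  have ilZ : (i, l.+1) \in Z by rewrite lenP e leqnn.
  by have := Zdown _ _ _ l.+1 ilZ ii' (leqnn l.+1); rewrite lenP.
have len_bound i : 0 < i <= n -> len i + n <= N.
  move=> i_n; case e: (len i) => [|l];
    first by rewrite -lan -[X in _ <= X]card_ord max_card.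
  have /ZN : (i, l.+1) \in Z by rewrite lenP e leqnn.
  by lia.
exists (st len_bound); first exact: card_st.
apply/fsetP => -[i j]; rewrite mem_dg_st // -lenP.
case: (boolP ((i, j) \in Z)) => ijZ; rewrite ?andbF ?andbT //.
by have [-> _] := Z0 _ _ ijZ; have [-> _] := ZN _ _ ijZ.
Qed.
End YoungState.

(** * Semistandard fillings *)

Section ZeroSet.
Variables (n N : nat) (la : {set 'I_N}).
Local Open Scope ring_scope.
Local Open Scope fset_scope.
Local Open Scope nat_scope.
Hypothesis lan : #|la| = n.
Let L := dg n la.
Implicit Types (f g : L -> nat) (A B : {set 'I_N}) (M : {fset nat * nat}).

(* Semistandard fillings of the complement of M in L with entries below T,    *)
(* extended by zero.                                                          *)
Definition ssyt_lt (T : nat) M f : Prop :=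
  [/\ forall u, val u \in M -> f u = 0,
      forall u v, val u \notin M -> val v \notin M ->
        (val u).1 = (val v).1 -> (val u).2 <= (val v).2 -> f u <= f v,
      forall u v, val u \notin M -> val v \notin M ->
        (val u).2 = (val v).2 -> (val u).1 < (val v).1 -> f u < f v
    & forall u, val u \notin M -> f u < T].

Definition zeros f : {fset nat * nat} := [fset val u | u : L & f u == 0].

Lemma in_zeros f (u : L) : (val u \in zeros f) = (f u == 0).
Proof.
apply/imfsetP/idP => [[v /= fv /val_inj->]|fu]; first by [].
by exists u.
Qed.

Lemma zeros_sub f : zeros f `<=` L.
Proof. by apply/fsubsetP => v /imfsetP[u _ ->]; apply: valP. Qed.

Lemma eq_zeros f M : M `<=` L -> (forall u : L, (f u == 0) = (val u \in M)) ->
  zeros f = M.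
Proof.
move=> ML fM; apply/fsetP => v; apply/idP/idP => [vz|vM].
  have vL := fsubsetP (zeros_sub f) _ vz.
  by rewrite -[v]/(val (Sub v vL : L)) -fM -in_zeros.
have vL := fsubsetP ML _ vM.
by rewrite -[v]/(val (Sub v vL : L)) in_zeros fM.
Qed.

Lemma dg_down A i j i' j' : #|A| = n -> (i, j) \in dg n A ->
  0 < i' <= i -> 0 < j' <= j -> (i', j') \in dg n A.
Proof. by move=> /dg_young[_]; apply. Qed.

(** From a zero one moves left, where entries do not increase, and then up, where any cell strictly
    above a zero must lie in [dg n A]. *)
Lemma zeros_young T A f : #|A| = n -> ssyt_lt T (dg n A) f -> is_young (zeros f).
Proof.
move=> An [f0 fr fc _]; have [L0 Ldown] := dg_young lan.
split=> [i j /(fsubsetP (zeros_sub f))/L0 //|i j i' j' ijZ i'i j'j].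
have ijL := fsubsetP (zeros_sub f) _ ijZ; have [i0 j0] := L0 _ _ ijL.
have ij'L : (i, j') \in L by apply: Ldown ijL _ _ => //; rewrite i0 leqnn.
have i'j'L : (i', j') \in L by apply: Ldown ijL _ _.
pose v : L := Sub (i, j) ijL; pose z : L := Sub (i, j') ij'L;
  pose u : L := Sub (i', j') i'j'L.
have /eqP fv : f v == 0 by rewrite -in_zeros.
have fz : f z = 0.
  case: (boolP (val z \in dg n A)) => [/f0 //|zA]; apply/eqP; rewrite -leqn0 -fv.
  have [_ le_j'j] := andP j'j; apply: fr => //; apply: contraNN zA => vA.
  by apply: (dg_down An vA); rewrite // i0 leqnn.
change (val u \in zeros f); rewrite in_zeros.
case: (boolP (val u \in dg n A)) => [/f0->//|uA].
have zA : val z \notin dg n A.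
  apply: contraNN uA => zA; have [j'0 _] := andP j'j.
  by apply: (dg_down An zA); rewrite // j'0 leqnn.
case/andP: i'i => i'0; rewrite leq_eqVlt => /orP[/eqP ii'|lt_i'].
  by apply/eqP; rewrite -fz; congr (f _); apply: val_inj; rewrite /= ii'.
by have := fc u z uA zA erefl lt_i'; rewrite fz.
Qed.

(** Columns increase strictly outside [dg n A], so each contains at most one new zero; off the
    zeros, lowering by one keeps all inequalities. *)
Lemma ssyt_zeros T A B f : #|A| = n -> #|B| = n -> dg n A `<=` L ->
  ssyt_lt T.+1 (dg n A) f -> dg n B = zeros f ->
  hstrip A B /\ ssyt_lt T (dg n B) (fun u => (f u).-1).
Proof.
move=> An Bn AL [f0 fr fc fT] BE.
have inB (u : L) : (val u \in dg n B) = (f u == 0) by rewrite BE in_zeros.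
have AB (u : L) : val u \notin dg n B -> val u \notin dg n A.
  by rewrite inB; apply: contraNN => /f0->.
split.
  apply/(hstrip_dgP An Bn); split.
    by apply/fsubsetP => v vA; have vL := fsubsetP AL _ vA;
       rewrite -[v]/(val (Sub v vL : L)) inB f0.
  move=> i j i0 i1B; have i1L : (i.+1, j) \in L.
    by apply: (fsubsetP (zeros_sub f)); rewrite -BE.
  have [_ j0] := (dg_young lan).1 _ _ i1L.
  have ijL : (i, j) \in L by apply: (dg_down lan i1L); rewrite ?i0 ?j0 ?leqnn ?leqnSn.
  pose u : L := Sub (i, j) ijL; pose v : L := Sub (i.+1, j) i1L.
  have /eqP fv : f v == 0 by rewrite -inB.
  apply/negPn/negP => uA; have vA : val v \notin dg n A.
    by apply: contraNN uA => vA; apply: (dg_down An vA); rewrite ?i0 ?j0 ?leqnn ?leqnSn.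
  by have := fc u v uA vA erefl (leqnn _); rewrite fv.
split=> [u|u v uB vB e le_uv|u v uB vB e lt_uv|u uB].
- by rewrite inB => /eqP->.
- by have := fr u v (AB _ uB) (AB _ vB) e le_uv; lia.
- by have := fc u v (AB _ uB) (AB _ vB) e lt_uv; move: uB; rewrite inB; lia.
by have := fT u (AB _ uB); move: uB; rewrite inB; lia.
Qed.

Lemma ssyt_succ T A B g : #|A| = n -> #|B| = n -> hstrip A B ->
  ssyt_lt T (dg n B) g ->
  ssyt_lt T.+1 (dg n A) (fun u => if val u \in dg n B then 0 else (g u).+1).
Proof.
move=> An Bn /(hstrip_dgP An Bn)[AB col] [g0 gr gc gT]; have [B0 Bdown] := dg_young Bn.
split=> [u uA|u v uA vA|u v uA vA|u uA].
- by rewrite (fsubsetP AB).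
- move: u v uA vA => [[i j] uL] [[i' j'] vL] /= uA vA e le_j; subst i'.
  case: ifPn => // uB; case: ifPn => vB; last by rewrite ltnS gr.
  have [i0 j0] := (dg_young lan).1 _ _ uL.
  by rewrite (Bdown _ _ _ _ vB) ?i0 ?j0 ?leqnn in uB.
- move: u v uA vA => [[i j] uL] [[i' j'] vL] /= uA vA e lt_i; subst j'.
  have [i0 j0] := (dg_young lan).1 _ _ uL.
  case: ifPn => uB; case: ifPn => vB //; last by rewrite ltnS gc.
    have i1B : (i.+1, j) \in dg n B by apply: (Bdown _ _ _ _ vB);
      rewrite ?lt_i ?j0 ?leqnn.
    by rewrite (col i j i0 i1B) in uA.
  by rewrite (Bdown _ _ _ _ vB) ?i0 ?j0 ?leqnn ?(ltnW lt_i) in uB.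
by case: ifPn => // uB; rewrite ltnS gT.
Qed.

Section Recursion.
Variables (R : comNzRingType) (x : nat * nat -> R) (K : nat).

Local Notation nf f := (fun u : L => nat_of_ord (f u)).

(** The codomain ['I_K.+1] makes the sum finite; [T] is the bound that the recursion lowers. *)
Definition ssyt_sum T A : R :=
  (\sum_(f : {ffun L -> 'I_K.+1} | `[< ssyt_lt T (dg n A) (nf f) >])
     \prod_(u : L) x (val u) ^+ f u)%R.

Lemma ssyt_sum_rec T A : T <= K -> #|A| = n -> dg n A `<=` L ->
  (ssyt_sum T.+1 A =
   \sum_(B : {set 'I_N} | [&& hstrip A B, #|B| == n & dg n B `<=` L])
     (\prod_(u : L | val u \notin dg n B) x (val u)) * ssyt_sum T B)%R.
Proof.
move=> TK An AL; rewrite /ssyt_sum.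
(* The default [A] is never reached on a semistandard filling: by [young_state] its zero set is the
   diagram of a bead set. *)
pose Bof (f : {ffun L -> 'I_K.+1}) : {set 'I_N} :=
  odflt A [pick B : {set 'I_N} | (#|B| == n) && (dg n B == zeros (nf f))].
have BofP (f : {ffun L -> 'I_K.+1}) B : #|B| = n -> dg n B = zeros (nf f) -> Bof f = B.
  rewrite /Bof => Bn BE; case: pickP => [C /= /andP[/eqP Cn /eqP CE]|/(_ B)].
    by apply: (dg_inj Cn Bn); rewrite CE BE.
  by rewrite Bn BE !eqxx.
have Bof_spec (f : {ffun L -> 'I_K.+1}) : ssyt_lt T.+1 (dg n A) (nf f) ->
    #|Bof f| = n /\ dg n (Bof f) = zeros (nf f).
  move=> fA; have [B Bn BE] := young_state lan (zeros_young An fA) (zeros_sub (nf f)).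
  by rewrite (BofP _ _ Bn BE).
rewrite (partition_big Bof (fun B => [&& hstrip A B, #|B| == n & dg n B `<=` L])) /=;
  last first.
  move=> f /asboolP fA; have [Bn BE] := Bof_spec f fA.
  have [-> _] := ssyt_zeros An Bn AL fA BE.
  by rewrite Bn eqxx BE zeros_sub.
apply: eq_bigr => B /and3P[AB /eqP Bn BL].
pose up (g : {ffun L -> 'I_K.+1}) : {ffun L -> 'I_K.+1} :=
  [ffun u => if val u \in dg n B then ord0 else inord (g u).+1].
pose down (f : {ffun L -> 'I_K.+1}) : {ffun L -> 'I_K.+1} := [ffun u => inord (f u).-1].
have downE (f : {ffun L -> 'I_K.+1}) u : down f u = (f u).-1 :> nat.
  by rewrite ffunE inordK // (leq_ltn_trans (leq_pred _)).
(* [inord] is faithful here, since entries below [T <= K] can be raised by one within ['I_K.+1]. *)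
have upE (g : {ffun L -> 'I_K.+1}) u : ssyt_lt T (dg n B) (nf g) ->
    up g u = (if val u \in dg n B then 0 else (g u).+1) :> nat.
  move=> [_ _ _ gT]; rewrite ffunE; case: ifPn => // uB.
  by rewrite inordK // ltnS (leq_trans (gT _ uB)).
have eq_ssyt T' M (f g : L -> nat) : f =1 g -> ssyt_lt T' M f -> ssyt_lt T' M g.
  by move=> /funext->.
rewrite (reindex_onto up down) /=; last first.
  move=> f /andP[/asboolP fA /eqP fB]; have [_] := Bof_spec f fA; rewrite fB => BE.
  apply/ffunP => u; apply: val_inj => /=; rewrite ffunE BE in_zeros.
  case: eqP => [->//|/eqP fu]; rewrite downE prednK ?lt0n //.
  by rewrite inordK.
rewrite mulr_sumr; apply: eq_big => [g|g].
  apply/idP/asboolP => [/andP[/andP[/asboolP gA /eqP gB] /eqP dg_g]|gB].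
    have [_ BE] := Bof_spec _ gA; rewrite gB in BE.
    have [_] := ssyt_zeros An Bn AL gA BE; apply: eq_ssyt => u.
    by rewrite -downE dg_g.
  have upz : zeros (nf (up g)) = dg n B.
    by apply: eq_zeros => // u; rewrite upE //; case: ifP.
  have upA := ssyt_succ An Bn AB gB.
  apply/andP; split; first (apply/andP; split).
  - by apply/asboolP; apply: eq_ssyt upA => u; rewrite upE.
  - by rewrite (BofP _ B).
  apply/eqP/ffunP => u; apply: val_inj; rewrite /= downE upE //.
  by case: ifPn => // uB; have [-> //] := gB.
move=> /andP[/andP[/asboolP gA /eqP gB] /eqP dg_g].
have [_ BE] := Bof_spec _ gA; rewrite gB in BE.
have [_ gB'] := ssyt_zeros An Bn AL gA BE.
have {}gB' : ssyt_lt T (dg n B) (nf g).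
  by apply: eq_ssyt gB' => u; rewrite -downE dg_g.
rewrite [X in (X * _)%R]big_mkcond -big_split /=; apply: eq_bigr => u _.
rewrite upE //; case: ifPn => uB /=; last by rewrite exprS.
by have [-> //] := gB'; rewrite mul1r.
Qed.

Lemma ssyt_sum_self T : (ssyt_sum T la = 1)%R.
Proof.
rewrite /ssyt_sum (big_pred1 [ffun=> ord0]) => [|f].
  by rewrite big1 // => u _; rewrite ffunE.
apply/asboolP/eqP => [[f0 _ _ _]|->].
  by apply/ffunP => u; apply: val_inj; rewrite ffunE /= f0 ?fsvalP.
by split=> [u _|u v|u v|u]; rewrite ?ffunE ?fsvalP.
Qed.
End Recursion.
End ZeroSet.

(** * Partitions as lists of parts *)

Section Partitions.
Local Open Scope fset_scope.
Local Open Scope nat_scope.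
Variable la : seq nat.
Lemma part_out i : size la < i -> part la i = 0.
Proof. by move=> lt_i; rewrite /part nth_default //; lia. Qed.

Hypothesis hla : is_partition la.

Lemma part_down i i' : 0 < i' <= i -> part la i <= part la i'.
Proof.
move=> /andP[i'0 le_i]; have [i_la|/part_out->//] := leqP i (size la).
have [sla _] := andP hla; rewrite /part.
have tr : transitive geq by move=> y x z /= xy yz; apply: leq_trans yz xy.
by apply: (sorted_leq_nth tr leqnn 0 sla); rewrite ?inE; lia.
Qed.

Lemma part_gt0 i : 0 < i <= size la -> 0 < part la i.
Proof.
move=> i_la; have [_ la0] := andP hla; rewrite lt0n; apply: contraNneq la0 => <-.
have lt_i : i.-1 < size la by lia.
exact: mem_nth.
Qed.

Lemma mem_diagram (i j : nat) : ((i, j) \in diagram la) = [&& 0 < i, 0 < j & j <= part la i].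
Proof.
rewrite !inE /=; apply/allpairsPdep/and3P => [[i' [j' [+ + [-> ->]]]]|[i0 j0 jP]].
  by rewrite !mem_iota => i'P j'P; split; lia.
exists i, j; rewrite !mem_iota; split=> //; last by lia.
by have [|/part_out] := leqP i (size la); lia.
Qed.

Lemma conj_partE j : conj_part la j = count (fun i =>
  j <= part la i) (iota 1 (size la)).
Proof.
rewrite /conj_part -[X in count _ X](mkseq_nth 0) /mkseq count_map (iotaDl 1 0).
by rewrite count_map; apply: eq_count => i /=; rewrite /part add1n.
Qed.

Lemma conj_part_geq i j : 0 < i -> 0 < j -> (i <= conj_part la j) = (j <= part la i).
Proof.
move=> i0 j0; rewrite conj_partE; have [i_la|la_i] := leqP i (size la).
  apply: (@count_iota_down (fun i => j <= part la i)); last by rewrite i0.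
  by move=> k k' kk' /leq_trans; apply; apply: part_down.
rewrite part_out // (leqNgt j) j0; apply/negbTE; rewrite -ltnNge.
by apply: leq_ltn_trans la_i; rewrite -[X in _ <= X](size_iota 1) count_size.
Qed.

Lemma durfee_size_geq k : 0 < k -> (k <= durfee_size la) = (k <= part la k).
Proof.
move=> k0; have sqP m : 0 < m -> (square m `<=` diagram la) = (m <= part la m).
  move=> m0; apply/fsubsetP/idP => [sq|mP [i j]].
    have : (m, m) \in square m.
      by rewrite !inE /=; apply/allpairsP; exists (m, m); rewrite !mem_iota /=;
        split=> //; lia.
    by move/sq; rewrite mem_diagram => /and3P[].
  rewrite mem_diagram !inE => /allpairsP[[i' j'] /= [+ + [-> ->]]].
  by rewrite !mem_iota => i'm j'm; have := @part_down m i' ltac:(lia); lia.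
apply/idP/idP => [|kP]; last first.
  have k_la : k < (size la).+1 by rewrite ltnS leqNgt; apply/negP => /part_out; lia.
  by apply: (@leq_bigmax_cond _ _ _ (Ordinal k_la)); rewrite sqP.
apply: contraTT; rewrite -!ltnNge => lt_P.
suff : durfee_size la <= k.-1 by lia.
apply/bigmax_leqP => -[[|m] m_la] //= sq; rewrite sqP // in sq.
by rewrite -ltnS prednK // ltnNge; apply/negP => km;
  have := @part_down m.+1 k ltac:(lia); lia.
Qed.

Lemma mem_durfee (i j : nat) : ((i, j) \in durfee la) =
  [&& 0 < i, 0 < j, i <= part la i & j <= part la j].
Proof.
rewrite !inE; apply/allpairsP/and4P => [[[i' j'] /= [+ + [-> ->]]]|[i0 j0]].
  by rewrite !mem_iota => i'd j'd; split; rewrite -?durfee_size_geq; lia.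
rewrite -!durfee_size_geq // => iP jP.
by exists (i, j); rewrite !mem_iota /=; split=> //; lia.
Qed.

Lemma big_iota1 k (F : nat -> nat) : \sum_(i <- iota 1 k) F i = \sum_(i < k) F i.+1.
Proof. by rewrite -[k in iota 1 k](subn1 k.+1) big_add1 big_mkord. Qed.

Lemma big_diagram_rows (F : nat * nat -> nat) :
  \sum_(u <- diagram la) F u = \sum_(i < size la) \sum_(j < part la i.+1) F (i.+1, j.+1).
Proof.
rewrite (perm_big [seq (i, j) | i <- iota 1 (size la), j <- iota 1 (part la i)]) /=;
  last first.
  apply: uniq_perm; first exact: fset_uniq.
    apply: allpairs_uniq_dep => [|i _|[i j] [i' j'] _ _ /= [-> ->] //];
      exact: iota_uniq.
  by move=> u; rewrite inE.
by rewrite big_allpairs_dep big_iota1; apply: eq_bigr => i _; rewrite big_iota1.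
Qed.

Lemma big_diagram_cols (F : nat * nat -> nat) :
  \sum_(u <- diagram la) F u =
  \sum_(j < part la 1) \sum_(i < conj_part la j.+1) F (i.+1, j.+1).
Proof.
rewrite (perm_big [seq (i, j) | j <- iota 1 (part la 1), i <- iota 1 (conj_part la j)]) /=; last first.
  apply: uniq_perm; first exact: fset_uniq.
    apply: allpairs_uniq_dep => [|i _|[i j] [i' j'] _ _ /= [-> ->] //];
      exact: iota_uniq.
  move=> [i j]; rewrite mem_diagram;
    apply/and3P/allpairsPdep => [[i0 j0 jP]|[j' [i' [+ + [-> ->]]]]].
    exists j, i; rewrite !mem_iota; have := @part_down i 1 ltac:(lia).
    by have := conj_part_geq i0 j0; split=> //; lia.
  rewrite !mem_iota => j'P i'P; have i0 : 0 < i' by lia.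
  have j0 : 0 < j' by lia.
  by have := conj_part_geq i0 j0; split; lia.
by rewrite big_allpairs_dep big_iota1; apply: eq_bigr => j _; rewrite big_iota1.
Qed.

(** Summation by parts; it turns arm lengths into counts of array cells weakly to the left. *)
Lemma sum_mul_sub (f : nat -> nat) m :
  \sum_(j < m) f j * (m - j) = \sum_(j < m) \sum_(k < j.+1) f k.
Proof.
elim: m => [|m IH]; first by rewrite !big_ord0.
rewrite big_ord_recr [RHS]big_ord_recr /= -IH subSnn muln1 big_ord_recr /= addnA.
congr (_ + _); rewrite -big_split /=; apply: eq_bigr => j _.
by rewrite subSn ?mulnS 1?addnC // ltnW.
Qed.

Lemma sum_mul_subS (f : nat -> nat) m :
  \sum_(j < m) f j * (m - j.+1) = \sum_(j < m) \sum_(k < j) f k.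
Proof.
case: m => [|m]; first by rewrite !big_ord0.
rewrite big_ord_recr [RHS]big_ord_recl /= big_ord0 subnn muln0 addn0 add0n.
by rewrite -sum_mul_sub; apply: eq_bigr => j _; rewrite subSS.
Qed.

Lemma hookE (i j : nat) : (i, j) \in diagram la ->
  hook la (i, j) = (part la i - j).+1 + (conj_part la j - i).
Proof.
rewrite mem_diagram /hook /= => /and3P[i0 j0 jP].
by have := conj_part_geq i0 j0; rewrite jP; lia.
Qed.

Section ArrHooks.
Variable D : {fset nat * nat}.
Hypothesis hD : forall i j, i < size la -> Yh D i j.+1 <= Yh D i j <= (Yh D i j.+1).+1.

(** Telescoping: the array records the drops of the height from its value [i] on the left border. *)
Lemma sum_arr_row i j : i < size la ->
  \sum_(k < j) arr D (i.+1, k.+1) + Yh D i j = i.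
Proof.
move=> i_la; elim: j => [|j IH]; first by rewrite big_ord0 Yh0.
rewrite big_ord_recr /= -[RHS]IH -addnA; congr (_ + _).
by have := hD j i_la; rewrite /arr /=; lia.
Qed.

(** A vertical step is a horizontal step to the left, which gains [arr], followed by a diagonal
    step, which gains membership in [D]. *)
Lemma sum_arr_col i j : i <= size la ->
  \sum_(k < i) (arr D (k.+1, j.+1) + ((k.+1, j.+1) \in D)) = Yh D i j.+1.
Proof.
elim: i => [|i IH] i_la; first by rewrite big_ord0.
rewrite big_ord_recr /= IH ?(ltnW i_la) // YhS.
by have := hD j i_la; rewrite /arr /=; lia.
Qed.

(* Double counting of pairs of cells: the hooks of the cells of arr D cover   *)
(* the cell (i, j) exactly i - 1 - Yh (i - 1, j) times through their rows, and    *)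
(* arr D together with D meets the part of column j above (i, j) exactly      *)
(* Yh (i - 1, j) times.                                                       *)
Lemma sum_hook_arr :
  \sum_(u <- diagram la) arr D u * hook la u =
  \sum_(u <- (diagram la `\` D)%fset) (conj_part la u.2 - u.1).
Proof.
have -> : \sum_(u <- diagram la) arr D u * hook la u =
    \sum_(u <- diagram la) arr D u * (part la u.1 - u.2).+1 +
    \sum_(u <- diagram la) arr D u * (conj_part la u.2 - u.1).
  rewrite -big_split /= big_seq [RHS]big_seq; apply: eq_bigr => -[i j] ijL.
  by rewrite hookE // mulnDr.
have -> : \sum_(u <- diagram la) arr D u * (part la u.1 - u.2).+1 =
    \sum_(u <- diagram la) (u.1.-1 - Yh D u.1.-1 u.2).
  rewrite !big_diagram_rows; apply: eq_bigr => i _ /=.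
  rewrite (eq_bigr (fun j : 'I_(part la i.+1) =>
    arr D (i.+1, j.+1) * (part la i.+1 - j))); last first.
    by move=> j _; rewrite subnSK.
  rewrite (sum_mul_sub (fun j => arr D (i.+1, j.+1) : nat)); apply: eq_bigr => j _.
  by have /= := sum_arr_row j.+1 (ltn_ord i); lia.
have col (F : nat * nat -> nat) :
    \sum_(u <- diagram la) F u * (conj_part la u.2 - u.1) =
    \sum_(u <- diagram la) \sum_(k < u.1.-1) F (k.+1, u.2).
  rewrite !big_diagram_cols; apply: eq_bigr => j _ /=.
  exact: (sum_mul_subS (fun i => F (i.+1, j.+1))).
have -> : \sum_(u <- (diagram la `\` D)%fset) (conj_part la u.2 - u.1) =
    \sum_(u <- diagram la) (u \notin D) * (conj_part la u.2 - u.1).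
  have -> : (diagram la `\` D = [fset u in diagram la | u \notin D])%fset.
    by apply/fsetP => u; rewrite !inE andbC.
  by rewrite -big_fset_condE /= big_mkcond; apply: eq_bigr => u _; case: (u \notin D);
    rewrite ?mul1n.
rewrite !col -big_split /= big_seq [RHS]big_seq; apply: eq_bigr => -[i j].
rewrite mem_diagram /= => /and3P[i0 j0 jP].
have i_la : i <= size la by rewrite leqNgt; apply/negP => /part_out; lia.
case: i j i0 j0 jP i_la => [//|i] [//|j] _ _ _ i_la /=.
have := sum_arr_col j (ltnW i_la); rewrite big_split /= => E.
have le_i : Yh D i j.+1 <= i by rewrite -[X in _ <= X](sum_arr_row j.+1 i_la) leq_addl.
have E' : \sum_(k < i) ((k.+1, j.+1) \in D) + \sum_(k < i) ((k.+1, j.+1) \notin D) = i.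
  rewrite -big_split /= (eq_bigr (fun=> 1)) ?sum1_card ?card_ord //.
  by move=> k _; case: (_ \in D).
move: le_i; rewrite -E -[X in _ <= X]E' -[X in X - _ + _]E'.
set x := (X in X + _ <= _); set y := (X in _ + X <= _); set z := (X in _ <= _ + X).
by rewrite [x + y]addnC leq_add2l subnDl => /subnK.
Qed.
End ArrHooks.
End Partitions.

(** * Monomials of bead sets as products of diagonal weights *)

Section Monomials.
Variables (R : comNzRingType) (n N : nat) (x : nat * nat -> R) (Z : 'I_N -> R).
Local Open Scope ring_scope.
Local Open Scope fset_scope.
Local Open Scope nat_scope.
Implicit Types A B la : {set 'I_N}.
Hypothesis xZ : forall (a b : 'I_N) c, b.+1 = a :> nat -> n + c.2 = a + c.1 ->
  (Z b = x c * Z a)%R.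

(** Corners are removed one by one down to the empty shape; each removal multiplies the monomial by
    the weight of the cell removed. *)
Lemma monom_dg_base B : #|B| = n -> exists B0 : {set 'I_N},
  [/\ #|B0| = n, dg n B0 = fset0
    & (monom Z B * \prod_(c <- dg n B) x c = monom Z B0)%R].
Proof.
have [k] := ubnP #|` dg n B|; elim: k B => // k IH B ltk Bn.
have [/existsP[a /existsP[b /and3P[/eqP ab aB bB]]]|noc] :=
  boolP [exists a : 'I_N, exists b : 'I_N, [&& b.+1 == a :> nat, a \in B & b \notin B]]; last first.
  have B0 : dg n B = fset0.
    apply: dg_no_corner => // a b ab aB; apply: contraNT noc => bB.
    by apply/existsP; exists a; apply/existsP; exists b; rewrite ab eqxx aB.
  by exists B; rewrite B0 big_seq_fset0 mulr1.
have [cin _ _] := dg_corner ab Bn aB bB.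
have [_ _ cE _ _] := dg_cellE ab Bn aB bB.
have swE := dg_sw ab Bn aB bB.
have [||B0 [B0n B0E BE]] := IH (sw a b B).
- by move: ltk; rewrite swE (cardfsD1 (dg_cell n a B)) cin.
- by rewrite card_sw.
exists B0; split=> //; rewrite -BE swE (monom_sw_outer (xZ ab cE)) //.
by rewrite (big_fsetD1 _ cin) /= mulrCA mulrA.
Qed.

Lemma monom_dg la B : #|la| = n -> #|B| = n -> dg n B `<=` dg n la ->
    (forall c, GRing.lreg (x c)) ->
  (monom Z B = (\prod_(u : dg n la | val u \notin dg n B) x (val u)) * monom Z la)%R.
Proof.
move=> lan Bn Bla xreg; have [la0 [la0n la0E laE]] := monom_dg_base lan.
have [B0 [B0n B0E BE]] := monom_dg_base Bn.
have e0 : B0 = la0 by apply: (dg_inj B0n la0n); rewrite B0E la0E.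
have : GRing.lreg (\prod_(c <- dg n B) x c)%R.
  by elim/big_rec: _ => [|c y _]; [apply: lreg1 | apply: lregM].
apply; rewrite /= [LHS]mulrC BE e0 -laE (bigID (fun c => c \in dg n B)) /=.
rewrite big_fset_condE -(big_seq_fsetE _ _ (fun c => c \notin dg n B)) /=.
have -> : [fset c in dg n la | c \in dg n B] = dg n B.
  by apply/fsetP => c; rewrite 2!inE /= andbC; case: (boolP (c \in dg n B)) => // cB;
    rewrite (fsubsetP Bla).
by rewrite mulrC mulrA.
Qed.
End Monomials.

(** * Units, regular elements and divisibility by q *)

Section Series.
Local Open Scope ring_scope.

Lemma fcoefX_mul (R : comNzRingType) (f : fps R) k :
  fcoef (fpsX R * f) k = if k is k'.+1 then fcoef f k' else 0.
Proof.
case: k => [|k]; rewrite fcoef_mul; first by rewrite big_ord1 /= mul0r.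
rewrite !big_ord_recl /= mul0r add0r mul1r subSS subn0 big1 ?addr0 // => i _.
by rewrite mul0r.
Qed.

Lemma fcoefC_mul (R : comNzRingType) (c : R) (f : fps R) k :
  fcoef (fpsC c * f) k = c * fcoef f k.
Proof.
rewrite fcoef_mul big_ord_recl /= subn0 big1 ?addr0 // => i _.
by rewrite mul0r.
Qed.

Lemma lreg_fpsX (R : comNzRingType) : GRing.lreg (fpsX R).
Proof.
move=> f g fg; apply: fpsP => k.
by have := congr1 (fun h => fcoef h k.+1) fg; rewrite !fcoefX_mul.
Qed.

Lemma lreg_q : GRing.lreg q. Proof. exact: lreg_fpsX. Qed.

Lemma lreg_t : GRing.lreg t.
Proof.
move=> f g fg; apply: fpsP => k; apply: lreg_fpsX.
by rewrite -!fcoefC_mul -[fpsC _]/t fg.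
Qed.

Lemma lreg_qt a b : GRing.lreg (q ^+ a * t ^+ b).
Proof. by apply: lregM; apply: lregX; [apply: lreg_q | apply: lreg_t]. Qed.

Lemma fcoef_qX_small a k (f : qtseries) : (k < a)%N -> fcoef (q ^+ a * f) k = 0.
Proof.
elim: a k => // a IH k ka; rewrite exprS -mulrA fcoefX_mul.
by case: k ka => // k ka; apply: IH.
Qed.

Lemma unit_1sub_qX a (f : qtseries) : (0 < a)%N -> 1 - q ^+ a * f \is a GRing.unit.
Proof.
move=> a0; apply: fps_unit_coef0.
rewrite -[LHS]/(fcoef 1 0 - fcoef (q ^+ a * f) 0) fcoef_qX_small //.
exact: subr0.
Qed.

Lemma fcoef_mulq_congr (f g h : qtseries) T k :
    (forall j, (j < T)%N -> fcoef g j = fcoef h j) -> (k < T.+1)%N ->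
  fcoef (q * f * g) k = fcoef (q * f * h) k.
Proof.
move=> gh kT; rewrite -!mulrA !fcoefX_mul; case: k kT => // k kT.
by rewrite !fcoef_mul; apply: eq_bigr => i _;
  rewrite gh // (leq_ltn_trans (leq_subr i k)).
Qed.
End Series.

(** * Holes of a bead set and columns of the partition *)

Section PartitionState.
Local Open Scope fset_scope.
Local Open Scope nat_scope.
Variables (n N : nat) (la : seq nat).
Hypothesis hla : is_partition la.
Hypothesis la_N : forall i, 0 < i <= n -> part la i + n <= N.

Lemma dg_st_part : size la <= n -> dg n (st la_N) = diagram la.
Proof.
move=> la_n; apply/fsetP => -[i j]; rewrite mem_dg_st; last exact: part_down.
rewrite mem_diagram //; have [//|/part_out] := leqP i (size la); lia.
Qed.

Hypothesis size_n : size la = n.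

(** The holes up to [p] number the column of [p], and the beads above [p] are the rows that reach
    this column. *)
Lemma ht_st_conj (p : 'I_N) : p \notin st la_N ->
  0 < p.+1 + ht (st la_N) p - n /\ conj_part la (p.+1 + ht (st la_N) p - n) = ht (st la_N) p.
Proof.
set h := ht _ _ => pla; have hn : #|st la_N| = n by apply: card_st => i i';
  apply: part_down.
have h1 : h = ht (st la_N) p.+1 by rewrite /h htS (negPf pla).
have := ht_geq (st la_N) p.+1; rewrite hn -h1 => hp.
have hle : h <= n by rewrite -hn ht_card.
have [lt_p|] := ltnP n (p.+1 + h); last first.
  move=> le_n; have pE : p.+1 + h = n by lia.
  have h_n : h < n by lia.
  have := ht_st_geq (@part_down la hla) la_N p.+1 (Ordinal h_n) => /=.
  have := @part_gt0 la hla h.+1; rewrite size_n -h1 ltnn /row_pos /=.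
  by move=> /(_ h_n); lia.
split; first lia.
set j := p.+1 + h - n.
have hP i : 0 < i -> (i <= h) = (j <= part la i).
  move=> i0; have [i_n|n_i] := leqP i n; last first.
    by rewrite part_out ?size_n // /j; lia.
  have rows (k : 'I_n) := ht_st_geq (@part_down la hla) la_N p k.
  have rows1 (k : 'I_n) := ht_st_geq (@part_down la hla) la_N p.+1 k.
  rewrite -h1 in rows1; rewrite -/h in rows; rewrite /j.
  have [le_ih|lt_hi] := leqP i h.
    have h'n : h.-1 < n by lia.
    have := rows1 (Ordinal h'n); rewrite /row_pos /= prednK ?(leq_trans i0) // leqnn.
    by have := @part_down la hla h i; lia.
  have hn' : h < n by lia.
  have := rows (Ordinal hn'); rewrite /row_pos /= ltnn.
  by have := @part_down la hla i h.+1; lia.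
have j0 : 0 < j by rewrite /j; lia.
apply/eqP; rewrite eqn_leq; apply/andP; split.
  case e: (conj_part la j) => [//|k].
  by rewrite hP // -conj_part_geq ?e.
by case e: h => [//|k]; rewrite conj_part_geq // -hP ?e.
Qed.
End PartitionState.

(** * Hook lengths, the Durfee square and the common recursion *)

Section Specialization.
Local Open Scope fset_scope.
Local Open Scope nat_scope.
Variables (n N : nat) (la : seq nat).
Hypotheses (hla : is_partition la) (size_n : size la = n).
Hypothesis la_N : forall i, 0 < i <= n -> part la i + n <= N.
Let L := st la_N.
Let Ln : #|L| = n. Proof. by apply: card_st => i i'; apply: part_down. Qed.
Let LE : dg n L = diagram la.
Proof. by apply: dg_st_part; rewrite ?size_n. Qed.

Definition wt_cell (u : nat * nat) : qtseries :=
  (q ^+ hook la u * t ^+ (u \in durfee la))%R.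
(** Each step down gains a q, and the step from [n] to [n - 1], which crosses the main diagonal,
    also gains a t. *)
Definition wt_pos (p : 'I_N) : qtseries := (q ^+ (N - p) * t ^+ (p < n))%R.
Definition wt_diag (u : nat * nat) : qtseries := (q * t ^+ (u.1 == u.2))%R.

(** The cell of the bead [p] and the hole [p'] has hook length [p - p'], and it lies in the Durfee
    square exactly when [p' < n <= p]. *)
Lemma wt_pos_hook (p p' : 'I_N) : p' < p -> p \in L -> p' \notin L ->
  wt_pos p' = (wt_cell (ht L p, p'.+1 + ht L p' - n)%N * wt_pos p)%R.
Proof.
move=> lt_p /imsetP[i _ pE] p'L; have [j0 conjE] := ht_st_conj hla size_n p'L.
rewrite -/L in j0 conjE; set j := _ - n in j0 conjE *.
have pE' : p = part la i.+1 + n - i.+1 :> nat by rewrite pE.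
have rowE k (kn : k < n) := ht_st_geq (@part_down la hla) la_N p (Ordinal kn).
have hp : ht L p = i.+1.
  apply/eqP; rewrite eqn_leq; apply/andP; split; last first.
    by have /= -> := rowE i (ltn_ord i); rewrite pE' /row_pos.
  rewrite leqNgt; apply/negP => lt_h; have [i1n|] := ltnP i.+1 n.
    have := rowE i.+1 i1n; rewrite -/L lt_h /row_pos /= pE'.
    by have := @part_down la hla i.+2 i.+1; lia.
  by have := ht_card L p; rewrite Ln; lia.
have ht_p' : ht L p < (ht L p').+1 by have := ht_subn L p' (p - p');
  rewrite subnKC ?(ltnW lt_p) //; lia.
have ijla : (i.+1, j) \in diagram la.
  by rewrite mem_diagram // j0 -conj_part_geq // conjE /= -ltnS -hp.
have := ijla; rewrite mem_diagram // => /and3P[_ _ jP].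
rewrite hp /wt_pos /wt_cell mulrACA -exprD -exprD hookE // conjE.
have dE : (p' < n) = ((i.+1, j) \in durfee la) + (p < n) :> nat.
  have jh : (j <= part la j) = (j <= ht L p') by rewrite -conj_part_geq // conjE.
  rewrite mem_durfee // j0 jh /= pE' /j in jP *; have := ltn_ord i; move: lt_p;
    rewrite pE'.
  have := @part_down la hla i.+1 j; have := @part_down la hla j i.+1.
  by lia.
rewrite -dE; congr (q ^+ _ * _)%R; rewrite hp in ht_p'.
by have := ltn_ord p; have := ltn_ord i; move: lt_p ht_p' pE' jP; rewrite /j; lia.
Qed.

Lemma wt_pos_diag (a b : 'I_N) c : b.+1 = a :> nat -> n + c.2 = a + c.1 ->
  wt_pos b = (wt_diag c * wt_pos a)%R.
Proof.
move=> ab cE; rewrite /wt_pos /wt_diag mulrACA -exprS -exprD.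
have -> : (c.1 == c.2) + (a < n) = (b < n) by lia.
by congr (q ^+ _ * _)%R; have := ltn_ord a; lia.
Qed.

Lemma lreg_wt_diag c : GRing.lreg (wt_diag c).
Proof. exact: (@lreg_qt 1 (c.1 == c.2)). Qed.

Lemma unit_wt_cell u : u \in diagram la -> (1 - wt_cell u)%R \is a GRing.unit.
Proof. by case: u => i j uL; apply: unit_1sub_qX; rewrite hookE. Qed.

Let G := Gsum n wt_cell L.

(** This is [pieri] with the regular monomial of [L] cancelled by means of [monom_dg]. *)
Lemma Gsum_rec (A : {set 'I_N}) : #|A| = n ->
  (G A = \sum_(B : {set 'I_N} | [&& hstrip A B, #|B| == n & dg n B `<=` dg n L])
     (\prod_(u : dg n L | val u \notin dg n B) wt_diag (val u)) * G B)%R.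
Proof.
move=> An; have reg : GRing.lreg (monom wt_pos L).
  by rewrite /monom; elim/big_rec: _ => [|p y _]; [apply: lreg1 | apply/lregM/lreg_qt].
apply: reg; rewrite (pieri Ln wt_pos_hook _ An); last first.
  by move=> u; rewrite LE; apply: unit_wt_cell.
rewrite mulr_sumr [RHS]big_mkcond; apply: eq_bigr => B _.
case: ifPn => [/and3P[-> /eqP Bn BL]|].
  by rewrite mul1r (monom_dg wt_pos_diag Ln Bn BL lreg_wt_diag) -mulrA mulrCA mulrA.
case: (hstrip A B) => [/= noB|_]; last by rewrite !mul0r.
by rewrite /G /Gsum (negPf noB) mulr0.
Qed.

(** In the common recursion the term of [L] is 1 on both sides, and any other [B] leaves out a cell,
    whose factor q makes agreement in lower degrees sufficient. *)
Lemma fcoef_ssyt_sum K T (A : {set 'I_N}) k : T <= K.+1 -> #|A| = n ->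
  dg n A `<=` dg n L -> k < T ->
  fcoef (ssyt_sum n L wt_diag K T A) k = fcoef (G A) k.
Proof.
elim: T A k => // T IH A k TK An AL kT.
rewrite ssyt_sum_rec // Gsum_rec // !fcoef_sum;
  apply: eq_bigr => B /and3P[_ /eqP Bn BL].
have [->|BnL] := eqVneq B L.
  by rewrite ssyt_sum_self /G Gsum_self.
have [v vL vB] : exists2 v, v \in dg n L & v \notin dg n B.
  apply/fsubsetPn; apply: contraNN BnL => LB; apply/eqP/(dg_inj Bn Ln)/eqP.
  by rewrite eqEfsubset BL.
rewrite (bigD1 [` vL]) //; set P := (\prod_(u : dg n L | _ && _) _)%R.
have qE g : (wt_diag (val [` vL]) * P * g = q * (t ^+ (v.1 == v.2) * P) * g)%R.
  by rewrite /wt_diag !mulrA.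
rewrite !qE; apply: fcoef_mulq_congr kT => j jT; apply: IH => //; exact: ltnW.
Qed.
End Specialization.

(** * Excited arrays and the final specialization *)

Lemma mem_fset_cond (K : choiceType) (X : {fset K}) (P : pred K) u :
  (u \in [fset v in X | P v]%fset) = (u \in X) && P u.
Proof. by rewrite !inE. Qed.

Section Arrays.
Local Open Scope fset_scope.
Local Open Scope nat_scope.
Variables (n N : nat) (la mu : seq nat).
Hypotheses (hla : is_partition la) (hmu : is_partition mu) (size_n : size la = n).
Hypothesis la_N : forall i, 0 < i <= n -> part la i + n <= N.
Hypothesis mu_N : forall i, 0 < i <= n -> part mu i + n <= N.
Hypotheses (mu_la : diagram mu `<=` diagram la) (mu_n : size mu <= n).

Let L := st la_N.
Let M := st mu_N.
Let Ln : #|L| = n. Proof. by apply: card_st => i i'; apply: part_down. Qed.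
Let Mn : #|M| = n. Proof. by apply: card_st => i i'; apply: part_down. Qed.
Let LE : dg n L = diagram la.
Proof. by apply: dg_st_part; rewrite ?size_n. Qed.
Let ME : dg n M = diagram mu. Proof. exact: dg_st_part. Qed.
Let Ly : is_young (diagram la). Proof. by rewrite -LE; apply: dg_young. Qed.
Let ML : dg n M `<=` diagram la. Proof. by rewrite ME. Qed.
Let la_row i j : (i, j) \in diagram la -> i <= n.
Proof. by rewrite -LE; apply: dg_row. Qed.

Lemma excited_height_inv D : excited la mu D -> height_inv n (diagram la) M D.
Proof. by move/excitedE; rewrite -ME; apply: exc_height_inv. Qed.

Lemma excited_sub D : excited la mu D -> D `<=` diagram la.
Proof. by move/excitedE; apply: exc_sub. Qed.

Lemma init_arrayE v : v \in diagram la -> init_array la mu v = arr (diagram mu) v.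
Proof.
case: v => i j ijL; have i_n := la_row ijL.
move: (ijL); rewrite mem_diagram // => /and3P[i0 j0 jP].
have pN : n + j - i < N.
  by have := la_N (_ : 0 < i <= n); rewrite i0 i_n => /(_ isT); lia.
set p := Ordinal pN; have := htS M p => /= hp.
have -> : arr (diagram mu) (i, j) = (p \in M) && ((i, j) \notin diagram mu).
  rewrite /arr /= -ME !Yh_dg //; try lia.
  rewrite mem_dg // i0 j0 /= (_ : n + j - i.-1 = (n + j - i).+1); last by lia.
  rewrite (_ : n + j.-1 - i.-1 = n + j - i); last by lia.
  by rewrite hp; case: (p \in M); lia.
apply/hasP/andP => [[r]|[/imsetP[r _ pE] ijM]].
  rewrite mem_iota /diag_cells => r_n; rewrite 2!inE /= /skew_diagram in_fsetD.
  move=> /andP[/andP[ijM _] /eqP rE]; split=> //.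
  have r1n : r.-1 < n by lia.
  apply/imsetP; exists (Ordinal r1n) => //; apply: val_inj.
  by rewrite /= /row_pos /= prednK; lia.
have {}pE : n + j - i = part mu r.+1 + n - r.+1 by have := congr1 val pE.
have r_n := ltn_ord r.
exists r.+1; last first.
  rewrite /diag_cells 2!inE /= /skew_diagram in_fsetD ijM ijL /=; apply/eqP; lia.
(* The array omits the diagonal of the last row [n]. Nothing is lost: a cell of this diagonal
   outside [mu] would lie below row [n]. *)
rewrite mem_iota size_n; have [|n_r] := ltnP r.+1 n; first by lia.
move: ijM; rewrite mem_diagram // i0 j0 /= -ltnNge.
by have := @part_down mu hmu r.+1 i; lia.
Qed.

(** The height falls by one at the lattice point [u] only, so the unit drop on the horizontal step
    right of this point passes to the step on its left, as in [beta u]. *)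
Lemma act_arr D u : excited la mu D -> act (diagram la) D u ->
  [/\ arr D (u.1.+1, u.2) = false, arr D (u.1.+1, u.2.+1)
    & forall v, v \in diagram la -> beta u (arr D) v = arr (alpha u D) v].
Proof.
move=> eD act_u; have inv := excited_height_inv eD; have DL := excited_sub eD.
have [uD _ _] := and4P act_u; rewrite in_fsetD => /andP[u3D _].
case: u act_u uD u3D => i j act_u uD u3D; have [i0 j0] := Ly.1 _ _ (fsubsetP DL _ uD).
case: i j i0 j0 act_u uD u3D => [//|i] [//|j] _ _ act_u uD u3D.
have [_ e1 e2 e3 [e4 e5]] := act_heights la_row inv DL act_u.
split; rewrite /arr /=; first by rewrite e1 e3 ltnn.
  by rewrite e1 e4.
case=> i' j' vL; have [i'0 j'0] := Ly.1 _ _ vL.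
case: i' j' vL i'0 j'0 => [//|i'] [//|j'] vL _ _.
have YE k l : Yh (alpha (i.+1, j.+1) D) k l = Yh D k l - ((k, l) == (i.+1, j.+1)).
  by rewrite -(@Yh_alpha D (i.+1, j.+1)) // addnK.
rewrite /beta /= !YE !xpair_eqE !eqSS.
have [->|_] := eqVneq i' i.+1; last by rewrite /= !subn0.
have [->|_] := eqVneq j' j.+1.
  by rewrite (gtn_eqF (ltnSn j)) /= e1 e4; lia.
have [->|_] := eqVneq j' j; last by rewrite /= !subn0.
by rewrite /= e1 e3; lia.
Qed.

Lemma excited_pair_excited D A : excited_pair la mu D A -> excited la mu D.
Proof. by elim=> [|D' A' u _ IH act_u _]; [constructor | apply: excited_move]. Qed.

Lemma active_act D u : active la D u = act (diagram la) D u.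
Proof. by case: u. Qed.

(** Since [arr D] depends on [D] alone, this gives the independence of the excited array on [la]
    from the sequence of moves. *)
Lemma excited_pairE D A : excited_pair la mu D A ->
  forall v, v \in diagram la -> A v = arr D v.
Proof.
elim=> [v|{}D {}A u eDA IH act_u _ v vL]; first exact: init_arrayE.
have eD := excited_pair_excited eDA; rewrite active_act in act_u.
have [_ _ <- //] := act_arr eD act_u.
by rewrite /beta; case: ifP => // _; case: ifP => // _; apply: IH.
Qed.

Lemma excited_has_pair D : excited la mu D -> exists A, excited_pair la mu D A.
Proof.
elim=> [|{}D u eD [A eDA] act_u]; first by exists (init_array la mu); constructor.
exists (beta u A); apply: excited_pair_move => //; rewrite active_act in act_u.
have [b1 b2 _] := act_arr eD act_u; have AE := excited_pairE eDA.
case/and4P: act_u => _; rewrite !in_fsetD => /andP[_ u1L] _ /andP[_ u3L].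
by rewrite /beta_defined !AE // b1 b2.
Qed.

Lemma excited_arrayE D v : excited la mu D -> v \in diagram la ->
  excited_array la mu D v = arr D v.
Proof.
by move=> /excited_has_pair[A eDA]; apply: excited_pairE; apply: xgetPex; exists A.
Qed.

Lemma cexpE S : excited la mu S ->
  cexp la mu S = \sum_(u <- diagram la) (arr S u && (u \in durfee la)).
Proof.
move=> eS; rewrite /cexp card_fset_sum1.
have -> : Defs.support la (excited_array la mu S) `&` durfee la =
    [fset u in diagram la | arr S u && (u \in durfee la)].
  apply/fsetP => u; rewrite in_fsetI /Defs.support !mem_fset_cond /=.
  by have [uL|//] := boolP (u \in diagram la); rewrite excited_arrayE.
by rewrite -big_fset_condE /= big_mkcond; apply: eq_bigr => u _; case: (arr S u && _).
Qed.

Lemma aexpE S : excited la mu S ->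
  aexp la S = \sum_(u <- diagram la) arr S u * hook la u.
Proof.
move=> eS; rewrite sum_hook_arr // => i j i_la.
by have [I1 _ _] := excited_height_inv eS; apply: I1; rewrite -size_n ltnW.
Qed.

Lemma exc_termE S : excited la mu S ->
  (exc_term (wt_cell la) (diagram la) S = q ^+ aexp la S * t ^+ cexp la mu S *
    (\prod_(u <- ((diagram la `\` S) `&` durfee la)%fset)
       (1 - t * q ^+ hook la u)^-1) *
    (\prod_(u <- ((diagram la `\` S) `\` durfee la)%fset)
       (1 - q ^+ hook la u)^-1))%R.
Proof.
move=> eS; rewrite /exc_term -mulrA; congr (_ * _)%R.
  rewrite aexpE // cexpE // !expr_sum -big_split /=; apply: eq_bigr => u _.
  by rewrite /wt_cell exprMn -!exprM mulnC -mulnb [(_ \in _) * _]mulnC.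
rewrite (big_fsetID _ (fun u => u \in durfee la)) /=.
have -> : [fset u in diagram la `\` S | u \in durfee la] = (diagram la `\` S) `&` durfee la.
  by apply/fsetP => u; rewrite in_fsetI mem_fset_cond.
have -> : [fset u in diagram la `\` S | u \notin durfee la] = (diagram la `\` S) `\` durfee la.
  by apply/fsetP => u; rewrite in_fsetD mem_fset_cond andbC.
congr (_ * _)%R; rewrite big_seq [RHS]big_seq; apply: eq_bigr => u.
  by rewrite in_fsetI /wt_cell mulrC => /andP[_ ->].
by rewrite in_fsetD /wt_cell => /andP[/negPf-> _]; rewrite mulr1.
Qed.

Lemma excited_sumE : Gsum n (wt_cell la) L M =
  (\sum_(S <- excited_diagrams la mu)
    q ^+ aexp la S * t ^+ cexp la mu S *
    (\prod_(u <- ((diagram la `\` S) `&` durfee la)%fset)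
       (1 - t * q ^+ hook la u)^-1) *
    (\prod_(u <- ((diagram la `\` S) `\` durfee la)%fset)
       (1 - q ^+ hook la u)^-1))%R.
Proof.
rewrite /Gsum Mn eqxx LE ML /= /exc_sum ME.
have -> : excited_diagrams la mu = exc_fset (diagram la) (diagram mu).
  apply/fsetP => S; rewrite !inE; congr (_ && _).
  by apply/asboolP/asboolP; rewrite excitedE.
rewrite big_seq [RHS]big_seq; apply: eq_bigr => S /(exc_fsetP mu_la) eS.
by apply: exc_termE; apply/excitedE.
Qed.
End Arrays.

(** * Coefficients of the formal sum over tableaux *)

Section Truncation.
Local Open Scope fset_scope.
Local Open Scope nat_scope.
Variables (n N : nat) (la mu : seq nat) (L M : {set 'I_N}) (k : nat).
Hypotheses (LE : dg n L = diagram la) (ME : dg n M = diagram mu).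
Local Notation D := (skew_diagram la mu).
Local Notation bfilling := {ffun dg n L -> 'I_k.+1}.
Implicit Types (f : bfilling) (pi : filling la mu).

Let is_ssyt f := ssyt_lt k.+1 (dg n M) (fun u => f u : nat).

Definition ext_filling f (c : nat * nat) : nat :=
  oapp (fun u : dg n L => f u : nat) 0 (insub c).

Definition skew_filling f : filling la mu := [ffun v => ext_filling f (val v)].

Lemma skew_sub : D `<=` dg n L. Proof. by rewrite LE fsubDset fsubsetUr. Qed.

Lemma skewP (v : D) : val v \in dg n L /\ val v \notin dg n M.
Proof. by have := fsvalP v; rewrite in_fsetD -LE -ME => /andP[]. Qed.

Definition skew_cell (v : D) : dg n L := [` (skewP v).1].

Lemma skew_cell_out v : val (skew_cell v) \notin dg n M.
Proof. exact: (skewP v).2. Qed.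

Lemma ext_fillingE f (u : dg n L) : ext_filling f (val u) = f u.
Proof. by rewrite /ext_filling valK. Qed.

Lemma skew_fillingE f v : skew_filling f v = f (skew_cell v).
Proof. by rewrite ffunE -ext_fillingE. Qed.

Lemma out_skew (u : dg n L) : val u \notin dg n M -> exists v : D, skew_cell v = u.
Proof.
move=> uM; have uD : val u \in D by rewrite in_fsetD -LE -ME uM fsvalP.
by exists [` uD]; apply: val_inj.
Qed.

Lemma skew_filling_SSYT f : is_ssyt f -> SSYT la mu (skew_filling f).
Proof.
move=> [_ fr fc _]; split=> u v; rewrite !skew_fillingE => e lt_uv.
  by apply: fr; rewrite ?skew_cell_out.
by apply: fc; rewrite ?skew_cell_out.
Qed.

Lemma skew_filling_inj f g : is_ssyt f -> is_ssyt g ->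
  skew_filling f = skew_filling g -> f = g.
Proof.
move=> [f0 _ _ _] [g0 _ _ _] fg; apply/ffunP => u; apply: val_inj => /=.
have [uM|/out_skew[v <-]] := boolP (val u \in dg n M); first by rewrite f0 ?g0.
by rewrite -!skew_fillingE fg.
Qed.

Lemma skew_filling_surj pi : SSYT la mu pi -> weight pi <= k ->
  exists2 f, is_ssyt f & skew_filling f = pi.
Proof.
move=> [pr pc] pk; have pi_k v : pi v < k.+1.
  by rewrite ltnS (leq_trans _ pk) // /weight (bigD1 v) //= leq_addr.
pose f : bfilling := [ffun u => inord (oapp pi 0 (insub (val u)))].
have fE v : f (skew_cell v) = pi v :> nat.
  have -> : f (skew_cell v) = inord (pi v) by rewrite ffunE /= valK.
  by rewrite inordK.
exists f; last by apply/ffunP => v; rewrite skew_fillingE fE.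
split=> [u uM|u v /out_skew[u' <-] /out_skew[v' <-]|u v /out_skew[u' <-] /out_skew[v' <-]|u _] //.
- rewrite ffunE insubF ?inordK //=.
  by apply/negbTE; rewrite in_fsetD -ME uM.
- by rewrite !fE => e; apply: pr.
by rewrite !fE => e; apply: pc.
Qed.

Lemma sum_skew_filling f (g : nat * nat -> nat) : is_ssyt f ->
  \sum_(v : D) g (val v) * skew_filling f v = \sum_(u : dg n L) g (val u) * f u.
Proof.
move=> [f0 _ _ _].
transitivity (\sum_(c <- D) g c * ext_filling f c).
  by rewrite big_seq_fsetE; apply: eq_bigr => v _; rewrite ffunE.
rewrite (big_fset_incl _ skew_sub) => [|c cL cD].
  by rewrite big_seq_fsetE; apply: eq_bigr => u _; rewrite ext_fillingE.
rewrite -[c]/(val [` cL]) ext_fillingE f0 ?muln0 //.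
by move: cD; rewrite in_fsetD -LE -ME cL andbT negbK.
Qed.

Lemma ssyt_term f : is_ssyt f ->
  (\prod_(u : dg n L) wt_diag (val u) ^+ f u =
   q ^+ weight (skew_filling f) * t ^+ trace (skew_filling f))%R.
Proof.
move=> fP; have wE : weight (skew_filling f) = \sum_(u : dg n L) f u.
  have := sum_skew_filling (fun=> 1) fP.
  by under eq_bigr do rewrite mul1n; under [in RHS]eq_bigr do rewrite mul1n.
have tE : trace (skew_filling f) = \sum_(u : dg n L) ((val u).1 == (val u).2) * f u.
  rewrite -(sum_skew_filling (fun c => (c.1 == c.2) : nat) fP) /trace big_mkcond.
  by apply: eq_bigr => v _; case: ifP; rewrite ?mul1n.
rewrite wE tE !expr_sum -big_split /=; apply: eq_bigr => u _.
by rewrite /wt_diag exprMn -exprM.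
Qed.

(** Tableaux of weight above [k] do not contribute to the coefficient of q^k, and the others have
    all entries at most [k]. *)
Lemma fcoef_SSYT m :
  fcoef (fcoef (qtsum (SSYT la mu) (fun pi => q ^+ weight pi * t ^+ trace pi)%R) k) m =
  fcoef (fcoef (ssyt_sum n L wt_diag k k.+1 M) k) m.
Proof.
pose F pi := fcoef (fcoef (q ^+ weight pi * t ^+ trace pi)%R k) m.
pose P : set bfilling := [set f | is_ssyt f]%classic.
rewrite /qtsum; cbn [fcoef].
change (\sum_(pi \in SSYT la mu) F pi =
  fcoef (fcoef (ssyt_sum n L wt_diag k k.+1 M) k) m)%R.
rewrite -(@fsbig_widen _ _ _ _ (skew_filling @` P)%classic); last first.
- move=> pi [piS piP] /=; rewrite /F; have [lt_k|le_k] := ltnP k (weight pi).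
    by rewrite fcoef_qX_small.
  by case: piP; have [f fP fpi] := skew_filling_surj piS le_k; exists f.
- by move=> _ [f fP <-]; apply: skew_filling_SSYT.
rewrite fsbig_image; last first.
  by move=> f g; rewrite !inE => fP gP; apply: skew_filling_inj.
rewrite /ssyt_sum !fcoef_sum.
rewrite (bigfs _ (index_enum_uniq _)) => [|f _]; last by rewrite mem_index_enum.
rewrite (_ : [set` _]%classic = P); last first.
  by apply/seteqP; split=> f /=; [move=> /asboolP | move=> fP; apply/asboolP].
by apply: eq_fsbigr => f; rewrite inE => fP; rewrite /F ssyt_term.
Qed.
End Truncation.

Local Open Scope ring_scope.

Theorem theorem1p8 (la mu : seq nat) (hla : is_partition la)
    (hmu : is_partition mu) (hsub : (diagram mu `<=` diagram la)%fset) :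
  qtsum (SSYT la mu) (fun pi => q ^+ weight pi * t ^+ trace pi) =
  \sum_(S <- excited_diagrams la mu)
    q ^+ aexp la S * t ^+ cexp la mu S *
    (\prod_(u <- ((diagram la `\` S) `&` durfee la)%fset)
       (1 - t * q ^+ hook la u)^-1) *
    (\prod_(u <- ((diagram la `\` S) `\` durfee la)%fset)
       (1 - q ^+ hook la u)^-1).
Proof.
have row i : (0 < i <= size mu)%N -> (part mu i <= part la i)%N.
  move=> i_mu; have mu0 := part_gt0 hmu i_mu; have [i0 _] := andP i_mu.
  have /(fsubsetP hsub) : (i, part mu i) \in diagram mu by rewrite mem_diagram // i0 mu0 leqnn.
  by rewrite mem_diagram // => /and3P[].
have mu_la : (size mu <= size la)%N.
  case e: (size mu) => [//|s]; rewrite ltnNge; apply/negP => s_la.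
  have s_mu : (0 < s.+1 <= size mu)%N by rewrite e leqnn.
  by have := row _ s_mu; have := part_gt0 hmu s_mu;
    rewrite (part_out (s_la : (size la < s.+1)%N)); case: (part mu _).
(* This fixes [n = size la] and [N = part la 1 + size la], enough positions for the bead sets of
   both partitions. *)
have la_N i : (0 < i <= size la)%N -> (part la i + size la <= part la 1 + size la)%N.
  by move=> /andP[i0 _]; rewrite leq_add2r part_down // ltnS leq0n.
have mu_N i : (0 < i <= size la)%N -> (part mu i + size la <= part la 1 + size la)%N.
  move=> i_la; have [i_mu|/part_out->] := leqP i (size mu); last by rewrite leq_add2r.
  by apply: leq_trans (la_N i i_la); rewrite leq_add2r row // i_mu andbT;
    case/andP: i_la.
have LE := dg_st_part hla la_N (leqnn _); have ME := dg_st_part hmu mu_N mu_la.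
have mu_card : #|st mu_N| = size la by apply: card_st => i i'; apply: part_down.
apply: fpsP => k; apply: fpsP => m; rewrite (fcoef_SSYT k LE ME).
rewrite (fcoef_ssyt_sum hla (erefl _)) //; last by rewrite LE ME.
by rewrite (excited_sumE hla hmu (erefl _) la_N mu_N hsub mu_la).
Qed.
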